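(* The following two assertions are equivalent. (1) For every positive integer $n$, the $K$-vector space $\mathscr R^{\zeta}_{q+n}$ is spanned by $$\{\overline{\mathcal B^{S}_U(R^{S}_1)}: U\in\mathcal I_n\}\cup\{\overline{\mathcal C^{S}_V(R^{S}_1)}: V\in\mathcal I_n\}\cup\{\overline{\mathcal B^{S}_U\circ\mathcal C^{S}_V(R^{S}_1)}: U\in\mathcal I_l,\ V\in\mathcal I_m,\ l+m=n\}.$$ (2) For every positive integer $n$, the $K$-vector space $\mathscr R^{\mathrm{Li}}_{q+n}$ is spanned by $$\{\overline{\mathcal B^{\mathrm{Si}}_U(R^{\mathrm{Si}}_1)}: U\in\mathcal I_n\}\cup\{\overline{\mathcal C^{\mathrm{Si}}_V(R^{\mathrm{Si}}_1)}: V\in\mathcal I_n\}\cup\{\overline{\mathcal B^{\mathrm{Si}}_U\circ\mathcal C^{\mathrm{Si}}_V(R^{\mathrm{Si}}_1)}: U\in\mathcal I_l,\ V\in\mathcal I_m,\ l+m=n\}.$$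
   Context: Let $\mathbb F_q$ be a finite field with $q$ elements, $A=\mathbb F_q[\theta]$, $A_+$ the set of monic polynomials in $A$, $K=\mathbb F_q(\theta)$, $K_\infty=\mathbb F_q((\theta^{-1}))$. Tuples. A tuple is a finite, possibly empty, sequence of positive integers; $\mathcal I$ is the set of all tuples. The weight of $(s_1,\dots,s_r)$ is $\sum s_i$ ($0$ for $\emptyset$). $\mathcal I_w$ is the set of tuples of weight $w$, $\mathscr S_w$ is the $K$-vector space with basis $\mathcal I_w$, $\mathscr S=\bigoplus_{w\ge0}\mathscr S_w$. A nonempty tuple is written $\mathfrak s=(s_1,\mathfrak s^-)$ with $\mathfrak s^-$ possibly empty. For $a\ge1$ and $X\in\mathscr S$, $(a,X)$ is the $K$-linear extension of prefixing $a$ to a tuple. Power sums. For nonempty $\mathfrak s=(s_1,\dots,s_r)$ and $d\ge0$: $S_d(\mathfrak s)=\sum \frac{1}{a_1^{s_1}\cdots a_r^{s_r}}$ over $a_i\in A_+$ with $d=\deg a_1>\cdots>\deg a_r$; and, with $l_0=1$, $l_d=\prod_{k=1}^d(\theta-\theta^{q^k})$, $\mathrm{Si}_d(\mathfrak s)=\sum_{d=k_1>\cdots>k_r\ge0}\frac1{l_{k_1}^{s_1}\cdots l_{k_r}^{s_r}}$. For $d<0$ both are $0$. For $\emptyset$: $S_{-1}(\emptyset)=\mathrm{Si}_{-1}(\emptyset)=1$ and $S_d(\emptyset)=\mathrm{Si}_d(\emptyset)=0$ for $d\ne-1$. For nonempty $\mathfrak s$, $\zeta(\mathfrak s)=\sum_{d\ge0}S_d(\mathfrak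 s)$ and $\mathrm{Li}(\mathfrak s)=\sum_{d\ge0}\mathrm{Si}_d(\mathfrak s)$ in $K_\infty$. All are extended $K$-linearly to formal sums. $\mathscr R^\zeta_w=\{P\in\mathscr S_w:\zeta(P)=0\}$, $\mathscr R^{\mathrm{Li}}_w=\{P\in\mathscr S_w:\mathrm{Li}(P)=0\}$. Binary relations. For $w\ge1$, $\mathfrak{BR}^S_w$ (resp. $\mathfrak{BR}^{\mathrm{Si}}_w$) is the space of pairs $(P,Q)\in\mathscr S_w\oplus\mathscr S_w$ with $S_d(P)+S_{d+1}(Q)=0$ (resp. $\mathrm{Si}_d(P)+\mathrm{Si}_{d+1}(Q)=0$) for all $d\in\mathbb Z$. For $R=(P,Q)$ put $\overline R=P+Q$, an element of $\mathscr R^\zeta_w$ (resp. $\mathscr R^{\mathrm{Li}}_w$). With $D_1=\theta^q-\theta$, both $R_1^S\in\mathfrak{BR}^S_q$ and $R_1^{\mathrm{Si}}\in\mathfrak{BR}^{\mathrm{Si}}_q$ are the pair $\big((q),D_1(1,q-1)\big)$. Products. For $a,b\ge1$, $0<i<a+b$, let $\Delta^i_{a,b}=(-1)^{a-1}\binom{i-1}{a-1}+(-1)^{b-1}\binom{i-1}{b-1}$ if $(q-1)\mid i$, and $0$ otherwise. Bilinear products on $\mathscr S$ are defined for nonempty $\mathfrak s,\mathfrak t$ by $\mathfrak s\ast_S\mathfrak t=(s_1,\mathfrak s^-\ast_S\mathfrak t)+(t_1,\mathfrak s\ast_S\mathfrak t^-)+(s_1+t_1,\mathfrak s^-\ast_S\mathfrak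 t^-)+\sum_{0<i<s_1+t_1}\Delta^i_{s_1,t_1}(s_1+t_1-i,(i)\ast_S(\mathfrak s^-\ast_S\mathfrak t^-))$, $\mathfrak s\triangleleft_S\mathfrak t=(s_1,\mathfrak s^-\ast_S\mathfrak t)$, $\mathfrak s\diamond_S\mathfrak t=\mathfrak s\ast_S\mathfrak t-(s_1,\mathfrak s^-\ast_S\mathfrak t)-(t_1,\mathfrak s\ast_S\mathfrak t^-)$; $\mathfrak s\ast_{\mathrm{Si}}\mathfrak t=(s_1,\mathfrak s^-\ast_{\mathrm{Si}}\mathfrak t)+(t_1,\mathfrak s\ast_{\mathrm{Si}}\mathfrak t^-)+(s_1+t_1,\mathfrak s^-\ast_{\mathrm{Si}}\mathfrak t^-)$, $\mathfrak s\triangleleft_{\mathrm{Si}}\mathfrak t=(s_1,\mathfrak s^-\ast_{\mathrm{Si}}\mathfrak t)$, $\mathfrak s\diamond_{\mathrm{Si}}\mathfrak t=(s_1+t_1,\mathfrak s^-\ast_{\mathrm{Si}}\mathfrak t^-)$; with $\emptyset$ acting as identity for $\ast$ and $\diamond$ on both sides, and the formula for $\triangleleft$ also used for $\mathfrak t=\emptyset$. Operators. For $\bullet\in\{S,\mathrm{Si}\}$ and a nonempty tuple $W\in\mathcal I_k$, the linear maps $\mathcal B^\bullet_W,\mathcal C^\bullet_W:\mathfrak{BR}^\bullet_w\to\mathfrak{BR}^\bullet_{w+k}$ are $\mathcal B^\bullet_W(P,Q)=(W\triangleleft_\bullet P+W\diamond_\bullet Q+W\triangleleft_\bullet Q,\,0)$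 and $\mathcal C^\bullet_W(P,Q)=(P\diamond_\bullet W+P\triangleleft_\bullet W,\;Q\triangleleft_\bullet W)$. For $W=\emptyset$ they are the identity. *)

(* Defs.v *)
From HB Require Import structures.
From mathcomp Require Import all_boot all_order all_algebra.
From mathcomp Require Import boolp classical_sets.
From mathcomp.multinomials Require Import freeg.
From mathcomp Require Import zify.

Set Implicit Arguments.
Unset Strict Implicit.
Unset Printing Implicit Defensive.

Import GRing.Theory.
Local Open Scope ring_scope.
Local Open Scope classical_set_scope.

Local Notation "x %:F" := (@FracField.tofrac _ x).

Definition fps (F : Type) : Type := nat -> F.

Section PowerSeries.
Variable F : fieldType.
Implicit Types f g h : fps F.

Definition fps_add f g : fps F := fun n => f n + g n.
Definition fps_opp f : fps F := fun n => - f n.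
Definition fps_mul f g : fps F := fun n => \sum_(i < n.+1) f i * g (n - i)%N.
Definition fpsC (c : F) : fps F := fun n => if n == 0%N then c else 0.
Definition fpsX : fps F := fun n => (n == 1%N)%:R.

Fact fps_addA : associative fps_add.
Proof. by move=> f g h; apply/funext => n; exact: addrA. Qed.
Fact fps_addC : commutative fps_add.
Proof. by move=> f g; apply/funext => n; exact: addrC. Qed.
Fact fps_add0 : left_id (fpsC 0) fps_add.
Proof. by move=> f; apply/funext => -[|n]; exact: add0r. Qed.
Fact fps_addN : left_inverse (fpsC 0) fps_opp fps_add.
Proof. by move=> f; apply/funext => -[|n]; exact: addNr. Qed.

HB.instance Definition _ := gen_eqMixin (fps F).
HB.instance Definition _ := gen_choiceMixin (fps F).
HB.instance Definition _ :=
  GRing.isZmodule.Build (fps F) fps_addA fps_addC fps_add0 fps_addN.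

Definition fps_trunc N f : {poly F} := \poly_(i < N) f i.

Lemma fps_mulE N f g n : (n < N)%N ->
  fps_mul f g n = (fps_trunc N f * fps_trunc N g)`_n.
Proof.
move=> nN; rewrite coefM; apply: eq_bigr => i _; rewrite !coef_poly.
have -> : (i < N)%N by apply: leq_ltn_trans nN; rewrite -ltnS.
by rewrite (leq_ltn_trans (leq_subr _ _) nN).
Qed.

Lemma eq_coefM (p p' r r' : {poly F}) n :
  (forall i, (i <= n)%N -> p`_i = p'`_i) ->
  (forall i, (i <= n)%N -> r`_i = r'`_i) -> (p * r)`_n = (p' * r')`_n.
Proof.
move=> ep er; rewrite !coefM; apply: eq_bigr => i _.
by rewrite ep ?er ?leq_subr // -ltnS.
Qed.

Lemma fps_trunc_mul N f g n : (n < N)%N ->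
  (fps_trunc N (fps_mul f g))`_n = (fps_trunc N f * fps_trunc N g)`_n.
Proof. by move=> nN; rewrite coef_poly nN (fps_mulE _ _ nN). Qed.

Fact fps_mulA : associative fps_mul.
Proof.
move=> f g h; apply/funext => n; rewrite !(@fps_mulE n.+1) //.
transitivity ((fps_trunc n.+1 f * (fps_trunc n.+1 g * fps_trunc n.+1 h))`_n).
  by apply: eq_coefM => // i i_n; rewrite fps_trunc_mul.
by rewrite mulrA; apply: eq_coefM => // i i_n; rewrite fps_trunc_mul.
Qed.
Fact fps_mulC : commutative fps_mul.
Proof.
by move=> f g; apply/funext => n; rewrite !(@fps_mulE n.+1) // mulrC.
Qed.
Fact fps_mul1 : left_id (fpsC 1) fps_mul.
Proof.
move=> f; apply/funext => n; rewrite /fps_mul big_ord_recl /= mul1r subn0.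
by rewrite big1 ?addr0 // => i _; rewrite mul0r.
Qed.
Fact fps_mulD : left_distributive fps_mul fps_add.
Proof.
move=> f g h; apply/funext => n; rewrite /fps_mul /fps_add -big_split.
by apply: eq_bigr => i _; rewrite mulrDl.
Qed.
Fact fps_1neq0 : fpsC 1 != 0.
Proof. by apply/eqP => /(congr1 (@^~ 0%N)) /eqP; rewrite oner_eq0. Qed.

HB.instance Definition _ := GRing.Zmodule_isComNzRing.Build (fps F)
  fps_mulA fps_mulC fps_mul1 fps_mulD fps_1neq0.

Definition fps_unit : pred (fps F) := fun f => `[< exists g, g * f = 1 >].
Definition fps_inv f : fps F :=
  if fps_unit f then xget 0 [set g | g * f = 1] else f.

Fact fps_mulV : {in fps_unit, left_inverse 1 fps_inv *%R}.
Proof.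
move=> f uf; rewrite /fps_inv [fps_unit f]uf.
by have /asboolP/(@xgetPex _ 0 [set g | g * f = 1]) := uf.
Qed.
Fact fps_unitP f g : g * f = 1 -> fps_unit f.
Proof. by move=> gf; apply/asboolP; exists g. Qed.
Fact fps_inv_out : {in [predC fps_unit], fps_inv =1 id}.
Proof. by move=> f /negbTE uf; rewrite /fps_inv [fps_unit f]uf. Qed.

HB.instance Definition _ := GRing.ComNzRing_hasMulInverse.Build (fps F)
  fps_mulV fps_unitP fps_inv_out.

Lemma fps_neq0 f : f != 0 ->
  exists m, f m != 0 /\ forall i, (i < m)%N -> f i = 0.
Proof.
move=> f0; have : exists n, f n != 0.
  apply: contrapT => nf; move/eqP: f0; apply; apply/funext => n.
  by case: (eqVneq (f n) 0) => [->|fn]; [case: n|case: nf; exists n].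
move=> exf; case: (ex_minnP exf) => m fm min_m; exists m; split=> // i im.
by apply/eqP; apply: contraTT im => /min_m; rewrite -leqNgt.
Qed.

Fact fps_idomain f g : f * g = 0 -> (f == 0) || (g == 0).
Proof.
move=> fg0; apply/norP => -[/fps_neq0[a [fa af]] /fps_neq0[b [gb bg]]].
have /eqP := congr1 (@^~ (a + b)%N) fg0.
have aP : (a < (a + b).+1)%N by rewrite ltnS leq_addr.
have -> : (f * g) (a + b)%N = f a * g b.
  rewrite [LHS](bigD1 (Ordinal aP)) //= addKn big1 ?addr0 // => i.
  rewrite -val_eqE /= neq_ltn => /orP[ia|ai]; first by rewrite af ?mul0r.
  by rewrite bg ?mulr0 // ltn_subLR ?ltn_add2r // -ltnS.
have -> : (0 : fps F) (a + b)%N = 0 by rewrite /GRing.zero /=; case: (a + b)%N.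
by rewrite mulf_eq0 (negbTE fa) (negbTE gb).
Qed.

HB.instance Definition _ := GRing.ComUnitRing_isIntegral.Build (fps F)
  fps_idomain.

End PowerSeries.

(* F((1/theta)), built as the fraction field of F[[u]] with u = 1/theta *)
Definition Kinf (F : fieldType) := {fraction (fps F)}.

Lemma frac_numden (R : idomainType) (x : {fraction R}) :
  x = (\n_(repr x))%:F / (\d_(repr x))%:F.
Proof.
rewrite -{1}[x]reprK; case: (repr x) => -[a b] /= b0.
rewrite /FracField.tofrac; unlock.
rewrite -[_^-1]FracField.pi_inv -[RHS]FracField.pi_mul.
rewrite /FracField.mulf /FracField.invf !numden_Ratio ?oner_eq0 //.
rewrite mulr1 mul1r; congr (\pi)%qT.
by rewrite -[LHS]Ratio_numden.
Qed.

Section LaurentSeries.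
Variable F : fieldType.
Local Notation K := {fraction {poly F}}.

Fact fpsC_is_zmod_morphism : zmod_morphism (@fpsC F).
Proof. by move=> a b; apply/funext => -[|n] //; apply/esym/subr0. Qed.

Fact fpsC_is_monoid_morphism : monoid_morphism (@fpsC F).
Proof.
split=> // a b; apply/funext => n.
rewrite [RHS]/GRing.mul /= /fps_mul big_ord_recl big1 ?addr0 /= ?subn0.
  by case: n => //= n; rewrite mulr0.
by move=> i _; rewrite mul0r.
Qed.

HB.instance Definition _ :=
  GRing.isZmodMorphism.Build F (fps F) (@fpsC F) fpsC_is_zmod_morphism.
HB.instance Definition _ :=
  GRing.isMonoidMorphism.Build F (fps F) (@fpsC F) fpsC_is_monoid_morphism.

Definition uinf : Kinf F := (fpsX F)%:F.

(* theta |-> 1/u *)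
Definition Kinf_of_poly (p : {poly F}) : Kinf F :=
  (map_poly (@FracField.tofrac (fps F) \o @fpsC F) p).[uinf^-1].

Definition Kinf_of (x : K) : Kinf F :=
  Kinf_of_poly \n_(repr x) / Kinf_of_poly \d_(repr x).

(* The u^N F[[u]], N : nat, form a basis of neighbourhoods of 0 in F((u)). *)
Definition Kinf_cvg (x : nat -> Kinf F) (l : Kinf F) : Prop :=
  forall N : nat, exists n0 : nat, forall n : nat, (n0 <= n)%N ->
    exists f : fps F, x n - l = uinf ^+ N * f%:F.

Definition Kinf_sum (x : nat -> K) : Kinf F :=
  xget 0 [set l | Kinf_cvg (fun n => \sum_(d < n) Kinf_of (x d)) l].

Lemma fpsXnM N (f : fps F) n :
  (fpsX F ^+ N * f) n = if (n < N)%N then 0 else f (n - N)%N.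
Proof.
elim: N n => [|N IH] n; first by rewrite expr0 mul1r subn0.
have XM (g : fps F) m : (fpsX F * g) m = if m is m'.+1 then g m' else 0.
  rewrite /GRing.mul /= /fps_mul; case: m => [|m].
    by rewrite big_ord1 mul0r.
  rewrite big_ord_recl mul0r add0r big_ord_recl mul1r subSS subn0.
  by rewrite big1 ?addr0 // => i _; rewrite mul0r.
by rewrite exprS -mulrA XM; case: n => //= n; rewrite IH ltnS subSS.
Qed.

Lemma uinf_neq0 : uinf != 0.
Proof.
rewrite tofrac_eq0; apply/eqP => /(congr1 (@^~ 1%N)) /= /eqP.
by rewrite /fpsX eqxx oner_eq0.
Qed.

Lemma Kinf_cvg_uniq x l l' : Kinf_cvg x l -> Kinf_cvg x l' -> l = l'.
Proof.
move=> xl xl'; apply/eqP; rewrite -subr_eq0; set z := l - l'.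
have zP N : exists f : fps F, z = uinf ^+ N * f%:F.
  have [n1 P1] := xl N; have [n2 P2] := xl' N.
  have [f fE] := P1 _ (leq_maxl n1 n2); have [g gE] := P2 _ (leq_maxr n1 n2).
  exists (g - f); rewrite tofracB mulrBr -fE -gE /z.
  by rewrite opprB [RHS]addrC addrA subrK.
have dz : \d_(repr z) != 0 := denom_ratioP _.
rewrite [z]frac_numden mulf_eq0 invr_eq0 !tofrac_eq0 (negbTE dz) orbF.
apply/eqP/funext => n; have [f] := zP n.+1.
rewrite {1}[z]frac_numden => /(canRL (divfK _)).
rewrite tofrac_eq0 => /(_ dz) /eqP.
rewrite -tofracXn -!tofracM tofrac_eq -mulrA => /eqP ->.
by rewrite fpsXnM ltnSn; case: n.
Qed.

Lemma Kinf_of_poly_is_zmod_morphism : zmod_morphism Kinf_of_poly.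
Proof. by move=> p r; rewrite /Kinf_of_poly rmorphB /= hornerD hornerN. Qed.

Lemma Kinf_of_poly_is_monoid_morphism : monoid_morphism Kinf_of_poly.
Proof.
by split=> [|p r]; rewrite /Kinf_of_poly ?rmorph1 ?hornerC ?rmorphM ?hornerM.
Qed.

HB.instance Definition _ := GRing.isZmodMorphism.Build {poly F} (Kinf F)
  Kinf_of_poly Kinf_of_poly_is_zmod_morphism.
HB.instance Definition _ := GRing.isMonoidMorphism.Build {poly F} (Kinf F)
  Kinf_of_poly Kinf_of_poly_is_monoid_morphism.

Lemma Kinf_of_poly_eq0 p : (Kinf_of_poly p == 0) = (p == 0).
Proof.
apply/idP/eqP => [|->]; last by rewrite rmorph0.
apply: contraTeq => p0; set n := (size p).-1.
have szp : size p = n.+1 by rewrite prednK // size_poly_gt0.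
have u0 := uinf_neq0.
suff : uinf ^+ n * Kinf_of_poly p != 0.
  by rewrite mulf_eq0 negb_or => /andP[].
have -> : uinf ^+ n * Kinf_of_poly p =
    (\sum_(i < n.+1) fpsC p`_i * fpsX F ^+ (n - i))%:F.
  rewrite /Kinf_of_poly (@horner_coef_wide _ n.+1); last first.
    by rewrite size_map_poly szp.
  rewrite mulr_sumr rmorph_sum; apply: eq_bigr => -[i /= i_n] _.
  rewrite ltnS in i_n; rewrite coef_map /= rmorphM rmorphXn /=.
  rewrite mulrCA exprVn; congr (_ * _).
  by rewrite -{1}(subnK i_n) exprD mulfK // expf_neq0.
rewrite tofrac_eq0; apply/eqP => /(congr1 (@^~ 0%N)) /=.
rewrite (big_morph (fun f : fps F => f 0%N) (id1 := 0) (op1 := +%R)) //.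
rewrite big_ord_recr /= big1 => [|[i /= i_n] _]; last first.
  by rewrite mulrC fpsXnM subn_gt0 i_n.
rewrite add0r subnn expr0 mulr1 /fpsC /= => /eqP.
by rewrite -[_ == _]/(lead_coef p == 0) lead_coef_eq0 (negbTE p0).
Qed.

Lemma Kinf_of_frac p r : r != 0 ->
  Kinf_of (p%:F / r%:F) = Kinf_of_poly p / Kinf_of_poly r.
Proof.
move=> r0; set x := _ / _.
have dx : \d_(repr x) != 0 := denom_ratioP _.
have /eqP := frac_numden x.
rewrite /Kinf_of {1}/x eqr_div ?tofrac_eq0 // -!tofracM tofrac_eq => /eqP e.
by apply/eqP; rewrite eqr_div ?Kinf_of_poly_eq0 // -!rmorphM /= e.
Qed.

Lemma Kinf_of_is_zmod_morphism : zmod_morphism Kinf_of.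
Proof.
move=> x y; rewrite {1}[x]frac_numden {1}[y]frac_numden.
have dx : \d_(repr x) != 0 := denom_ratioP _.
have dy : \d_(repr y) != 0 := denom_ratioP _.
rewrite -mulNr addf_div ?tofrac_eq0 // -tofracN -!tofracM -tofracD.
rewrite Kinf_of_frac ?mulf_neq0 // rmorphD !rmorphM rmorphN /=.
by rewrite /Kinf_of -mulNr addf_div ?Kinf_of_poly_eq0.
Qed.

Lemma Kinf_of_is_monoid_morphism : monoid_morphism Kinf_of.
Proof.
split=> [|x y].
  by rewrite -[1]divr1 -tofrac1 Kinf_of_frac ?oner_eq0 // rmorph1 divr1.
rewrite {1}[x]frac_numden {1}[y]frac_numden.
have dx : \d_(repr x) != 0 := denom_ratioP _.
have dy : \d_(repr y) != 0 := denom_ratioP _.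
rewrite mulf_div -!tofracM Kinf_of_frac ?mulf_neq0 // !rmorphM /=.
by rewrite /Kinf_of mulf_div.
Qed.

HB.instance Definition _ := GRing.isZmodMorphism.Build K (Kinf F)
  Kinf_of Kinf_of_is_zmod_morphism.
HB.instance Definition _ := GRing.isMonoidMorphism.Build K (Kinf F)
  Kinf_of Kinf_of_is_monoid_morphism.

End LaurentSeries.

Section PowerSums.
Variable F : finFieldType.
Local Notation q := #|F|.
Local Notation K := {fraction {poly F}}.
Local Notation SS := {freeg (seq nat) / K}.

Definition theta : K := ('X : {poly F})%:F.

Definition tuples (w : nat) : set (seq nat) :=
  [set s | all (fun a => 0 < a)%N s /\ sumn s = w].

(* The ambient SS has all lists of naturals as basis; only the subspaces
   [homog w], spanned by the lists with positive entries and sum w, matter. *)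
Definition homog (w : nat) : set SS :=
  [set P | forall s, s \in dom P -> tuples w s].

Definition decreasing_from (d : nat) (k : seq nat) : bool :=
  (ohead k == Some d) && sorted gtn k.

Definition monic_chain (d : nat) (a : seq {poly F}) : bool :=
  all (fun p => p \is monic) a
  && decreasing_from d [seq (size p).-1 | p : {poly F} <- a].

(* S_d and Si_d are only needed for d >= 0, where both vanish on [::]. *)
Definition Ssum (s : seq nat) (d : nat) : K :=
  \sum_(a : (size s).-tuple {poly_d.+1 F} | monic_chain d (map val a))
     \prod_(i < size s) ((val (tnth a i))%:F ^+ nth 0%N s i)^-1.

Definition ell (d : nat) : K :=
  \prod_(1 <= k < d.+1) (theta - theta ^+ (q ^ k)).

Definition Sisum (s : seq nat) (d : nat) : K :=
  \sum_(k : (size s).-tuple 'I_d.+1 | decreasing_from d [seq val j | j <- k])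
     \prod_(i < size s) (ell (tnth k i) ^+ nth 0%N s i)^-1.

Definition extend (z : seq nat -> Kinf F) (P : SS) : Kinf F :=
  \sum_(s <- dom P) Kinf_of (coeff s P) * z s.

Definition zeta : SS -> Kinf F := extend (fun s => Kinf_sum (Ssum s)).
Definition Li : SS -> Kinf F := extend (fun s => Kinf_sum (Sisum s)).

Definition Rzeta (w : nat) : set SS := [set P | homog w P /\ zeta P = 0].
Definition RLi (w : nat) : set SS := [set P | homog w P /\ Li P = 0].

Definition prepend (a : nat) : SS -> SS := fglift (fun s => << a :: s >> : SS).

Definition Delta (a b i : nat) : K :=
  if (q.-1 %| i)%N then
    (-1) ^+ a.-1 * ('C(i.-1, a.-1))%:R + (-1) ^+ b.-1 * ('C(i.-1, b.-1))%:R
  else 0.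

(* n is fuel, sufficient as soon as it is at least depth s + depth t;
   starS_cons below is the intended recursion. *)
Fixpoint starS_rec (n : nat) (s t : seq nat) {struct n} : SS :=
  match n, s, t with
  | _, [::], _ => << t >>
  | _, _, [::] => << s >>
  | n'.+1, a :: s', b :: t' =>
      prepend a (starS_rec n' s' t) + prepend b (starS_rec n' s t')
      + prepend (a + b) (starS_rec n' s' t')
      + \sum_(1 <= i < a + b) Delta a b i
          *: prepend (a + b - i)
               (fglift (starS_rec n' [:: i]) (starS_rec n' s' t'))
  | 0%N, _ :: _, _ :: _ => 0
  end.

Definition depth (s : seq nat) : nat := (sumn s + size s)%N.

Definition starS (s t : seq nat) : SS := starS_rec (depth s + depth t) s t.

Definition diamS (s t : seq nat) : SS :=
  match s, t with
  | [::], _ => << t >>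
  | _, [::] => << s >>
  | a :: s', b :: t' =>
      starS s t - prepend a (starS s' t) - prepend b (starS s t')
  end.

Fixpoint starSi (s : seq nat) : seq nat -> SS :=
  fix starSi_s (t : seq nat) : SS :=
  match s, t with
  | [::], _ => << t >>
  | _, [::] => << s >>
  | a :: s', b :: t' =>
      prepend a (starSi s' t) + prepend b (starSi_s t')
      + prepend (a + b) (starSi s' t')
  end.

Definition diamSi (s t : seq nat) : SS :=
  match s, t with
  | [::], _ => << t >>
  | _, [::] => << s >>
  | a :: s', b :: t' => prepend (a + b) (starSi s' t')
  end.

Section Operators.
Variables star diam : seq nat -> seq nat -> SS.

(* The value at s = [::] is never used. *)
Definition tri (s t : seq nat) : SS :=
  if s is a :: s' then prepend a (star s' t) else 0.

(* The formulas make sense for every pair R, not only for binary relations. *)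
Definition opB (W : seq nat) (R : SS * SS) : SS * SS :=
  if W is [::] then R
  else (fglift (tri W) R.1 + fglift (diam W) R.2 + fglift (tri W) R.2, 0).

Definition opC (W : seq nat) (R : SS * SS) : SS * SS :=
  if W is [::] then R
  else (fglift (diam^~ W) R.1 + fglift (tri^~ W) R.1, fglift (tri^~ W) R.2).

End Operators.

Definition opBS := opB starS diamS.
Definition opCS := opC starS diamS.
Definition opBSi := opB starSi diamSi.
Definition opCSi := opC starSi diamSi.

(* The common underlying pair of R_1^S and R_1^Si. *)
Definition R1 : SS * SS :=
  (<< [:: q] >>, (theta ^+ q - theta) *: << [:: 1%N; q.-1] >>).

Definition overline (R : SS * SS) : SS := R.1 + R.2.

Definition lin_span (G : set SS) : set SS :=
  [set P | exists (m : nat) (c : 'I_m -> K) (g : 'I_m -> SS),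
             (forall i, G (g i)) /\ P = \sum_(i < m) c i *: g i].

Lemma fgliftE (f : seq nat -> SS) (P : SS) :
  fglift f P = \sum_(s <- dom P) coeff s P *: f s.
Proof.
pose g := fglift f.
have gB : {morph g : x y / x - y} := @lift_is_additive _ _ _ f.
have g0 : g 0 = 0 by rewrite -[X in g X](subrr 0) gB subrr.
have gD : {morph g : x y / x + y}.
  by move=> x y; rewrite -{1}[y]opprK gB -[- y]sub0r gB g0 sub0r opprK.
rewrite -{1}[P]freeg_sumE -/g (big_morph g gD g0).
by apply: eq_bigr => s _; rewrite /g liftU.
Qed.

Lemma starS_nil_l t : starS [::] t = << t >>.
Proof. by rewrite /starS; case: (depth _ + _)%N => /=; case: t. Qed.

Lemma starS_nil_r s : starS s [::] = << s >>.
Proof. by rewrite /starS; case: (depth _ + _)%N => /=; case: s. Qed.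

(* P only involves lists of depth at most d. *)
Let depth_le (d : nat) (P : SS) : Prop :=
  forall s, s \in dom P -> (depth s <= d)%N.

Let depth_leU d s : (depth s <= d)%N -> depth_le d << s >>.
Proof. by move=> sd t; rewrite domU1 inE => /eqP ->. Qed.

Let depth_leD d P Q : depth_le d P -> depth_le d Q -> depth_le d (P + Q).
Proof.
by move=> hP hQ s /domD_subset; rewrite mem_cat => /orP[/hP|/hQ].
Qed.

Let depth_leZ d c P : depth_le d P -> depth_le d (c *: P).
Proof. by move=> hP s /domZ_subset /hP. Qed.

Let depth_le_sum d (I : eqType) (r : seq I) (G : I -> SS) :
  (forall i, i \in r -> depth_le d (G i)) -> depth_le d (\sum_(i <- r) G i).
Proof.
elim: r => [|i r IH] hG; first by rewrite big_nil => s; rewrite dom0.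
rewrite big_cons; apply: depth_leD; first by apply: hG; rewrite mem_head.
by apply: IH => j jr; apply: hG; rewrite inE jr orbT.
Qed.

Let depth_le_lift d (f : seq nat -> SS) P :
  (forall s, s \in dom P -> depth_le d (f s)) -> depth_le d (fglift f P).
Proof.
move=> hf; rewrite fgliftE; apply: depth_le_sum => s sP.
by apply: depth_leZ; exact: hf.
Qed.

Let depth_cons a s : depth (a :: s) = (a + depth s).+1.
Proof. by rewrite /depth /= addnS addnA. Qed.

Let depth_le_prepend d a P :
  depth_le d P -> depth_le (a + d).+1 (prepend a P).
Proof.
move=> hP; apply: depth_le_lift => s /hP sd; apply: depth_leU.
by rewrite depth_cons ltnS leq_add2l.
Qed.

Let depth_le_trans d d' P : (d <= d')%N -> depth_le d P -> depth_le d' P.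
Proof. by move=> dd' hP s /hP sd; exact: leq_trans dd'. Qed.

Let depth_starS_rec n s t : depth_le (depth s + depth t) (starS_rec n s t).
Proof.
elim: n s t => [|n IH] [|a s] [|b t] /=;
  try by apply: depth_leU; rewrite ?leq_addr ?leq_addl.
  by move=> u; rewrite dom0.
have pp x P d : (x + d < depth (a :: s) + depth (b :: t))%N ->
    depth_le d P -> depth_le (depth (a :: s) + depth (b :: t)) (prepend x P).
  by move=> h /(@depth_le_prepend _ x); exact: depth_le_trans.
apply: depth_leD; [apply: depth_leD; [apply: depth_leD|]|].
- by apply: pp (IH _ _); rewrite !depth_cons; lia.
- by apply: pp (IH _ _); rewrite !depth_cons; lia.
- by apply: pp (IH _ _); rewrite !depth_cons; lia.
apply: depth_le_sum => i; rewrite mem_index_iota => /andP[i0 iab].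
apply: depth_leZ; apply: (pp _ _ (i.+1 + (depth s + depth t))%N).
  by rewrite !depth_cons; lia.
apply: depth_le_lift => u /IH uP; apply: depth_le_trans (IH _ _).
by rewrite depth_cons [depth [::]]/depth /=; lia.
Qed.

Let starS_rec_stable n m s t :
  (depth s + depth t <= n)%N -> (depth s + depth t <= m)%N ->
  starS_rec n s t = starS_rec m s t.
Proof.
elim: n m s t => [|n IH] m s t.
  by case: s => [|a s]; [case: m; case: t|rewrite depth_cons].
case: s => [|a s]; first by case: m; case: t.
case: t => [|b t]; first by case: m.
case: m => [|m]; first by rewrite depth_cons.
rewrite !depth_cons => nP mP /=.
have E u v : (depth u + depth v <= a + b + depth s + depth t)%N \/
             (depth u + depth v < a.+1 + depth s + (b + depth t).+1)%N ->
    starS_rec n u v = starS_rec m u v by move=> h; apply: IH; lia.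
rewrite (E s (b :: t)) ?(E (a :: s) t) ?(E s t); last 3 first.
- by right; lia.
- by right; rewrite depth_cons; lia.
- by right; rewrite depth_cons; lia.
congr (_ + _); apply: eq_big_nat => i /andP[i0 iab].
congr (_ *: prepend _ _); rewrite !fgliftE; apply: eq_big_seq => u uP.
have ud := depth_starS_rec uP.
by rewrite (E [:: i] u) // depth_cons [depth [::]]/depth /=; right; lia.
Qed.

Lemma starS_cons a s b t :
  starS (a :: s) (b :: t) =
    prepend a (starS s (b :: t)) + prepend b (starS (a :: s) t)
    + prepend (a + b) (starS s t)
    + \sum_(1 <= i < a + b) Delta a b i
        *: prepend (a + b - i) (fglift (starS [:: i]) (starS s t)).
Proof.
have E n u v : (depth u + depth v <= n)%N -> starS_rec n u v = starS u v.
  by move=> h; exact: starS_rec_stable.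
rewrite {1}/starS [depth (a :: s)]depth_cons addSn /=.
rewrite !E ?depth_cons; try lia.
congr (_ + _); apply: eq_big_nat => i /andP[i0 iab].
congr (_ *: prepend _ _); rewrite !fgliftE; apply: eq_big_seq => u uP.
have ud := depth_starS_rec uP.
by rewrite E // depth_cons [depth [::]]/depth /=; lia.
Qed.

Lemma starSi_cons a s b t :
  starSi (a :: s) (b :: t) =
    prepend a (starSi s (b :: t)) + prepend b (starSi (a :: s) t)
    + prepend (a + b) (starSi s t).
Proof. by []. Qed.

End PowerSums.

(* Main.v *)
(* Since S_d(1) = 1 / l_d, each factor 1 / l_d^a is a product of power sums.  So
   the linear map phi on words given by phi(a, s) = (1)^(diamond a) <| phi(s),
   where (a, X) <| Y = (a, X *_S Y), satisfies S_d(phi P) = Si_d(P), and hence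
   zeta(phi P) = Li(P).  It is triangular for the first entry, hence bijective in
   each weight, and it fixes R_1.  It remains to see that phi carries the
   operators B^Si_W and C^Si_W to the linear extensions of B^S and C^S at phi(W);
   this rests on formal identities between words such as the associativity of
   *_S.  They cannot be read off the sums S_d, which satisfy nontrivial linear
   relations.  But the product formula for S_d only uses that 1, theta, theta^2,
   ... are linearly independent over F_q: it holds for any F_q-independent
   x_0, x_1, ... in K instead.  These generalized power sums do separate words:
   as x_d runs over the infinite field K, sums with different first entries have
   poles of different orders at x_d = 0. *)

From HB Require Import structures.
Require Import Defs.
From mathcomp Require Import all_boot all_order all_algebra.
From mathcomp Require Import boolp classical_sets.
From mathcomp.multinomials Require Import freeg.
From mathcomp Require Import finfield zify ring.

Set Implicit Arguments.
Unset Strict Implicit.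
Unset Printing Implicit Defensive.

Import GRing.Theory.
Local Open Scope ring_scope.
Local Open Scope classical_set_scope.

(** * Power sums attached to a finite family of scalars *)

(** Sums over indices below d are the basic objects here: on the values S_{<d} the product [starS]
    becomes plain multiplication, and S_d is the increment of S_{<d} when x_d joins the family. On
    increments, the triangle product of nonempty words s, t has the value S_d(s) S_{<d}(t) and the
    diamond product the value S_d(s) S_d(t). So the values of B_W and C_W are linear in the values
    of W and remain correct when W is replaced by the combination phi(W). Separation of words turns
    this equality of values into an identity between words, and no associativity law has to be
    derived for words themselves. An arbitrary family has no l_d. Its inverse is replaced by S_d(1),
    so that the comparison of the two kinds of sums holds by construction; Carlitz's S_d(1) = 1 /
    l_d enters only for the family 1, theta, theta^2, .... Triangularity gives the surjectivity of
    phi. Injectivity comes from the fact that the sums built from powers of S_d(1) separate words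
    too. *)

Section Span.
Variables (F : finFieldType) (E : fieldType) (io : {rmorphism F -> E}).
Implicit Types (l : seq E) (x u v : E).

Fixpoint fspan l : seq E :=
  if l is x :: l' then [seq io c * x + v | c <- enum F, v <- fspan l']
  else [:: 0].

Fixpoint findep l : bool :=
  if l is x :: l' then (x \notin fspan l') && findep l' else true.

Lemma fspan_consP x l u :
  reflect (exists2 c, exists2 v, v \in fspan l & u = io c * x + v & true)
    (u \in fspan (x :: l)).
Proof.
apply: (iffP idP) => [/allpairsP[[c v] /= [_ vl ->]]|[c [v vl ->] _]].
  by exists c => //; exists v.
by apply/allpairsP; exists (c, v); rewrite mem_enum.
Qed.

Lemma big_fspan_cons x l (f : E -> E) :
  \sum_(v <- fspan (x :: l)) f v
    = \sum_c \sum_(v <- fspan l) f (io c * x + v).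
Proof. by rewrite big_allpairs_dep big_enum. Qed.

Lemma fspanD l u v : u \in fspan l -> v \in fspan l -> u + v \in fspan l.
Proof.
elim: l u v => [|x l IH] u v; first by rewrite !inE => /eqP-> /eqP->; rewrite addr0.
move=> /fspan_consP[c [u' u'l ->] _] /fspan_consP[d [v' v'l ->] _].
apply/fspan_consP; exists (c + d) => //; exists (u' + v'); first exact: IH.
by rewrite rmorphD mulrDl addrACA.
Qed.

Lemma fspanZ l c v : v \in fspan l -> io c * v \in fspan l.
Proof.
elim: l v => [|x l IH] v; first by rewrite !inE => /eqP->; rewrite mulr0.
move=> /fspan_consP[d [v' v'l ->] _].
apply/fspan_consP; exists (c * d) => //; exists (io c * v'); first exact: IH.
by rewrite rmorphM mulrDr mulrA.
Qed.

Lemma fspanN l v : v \in fspan l -> - v \in fspan l.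
Proof. by move=> /(fspanZ (-1)); rewrite rmorphN1 mulN1r. Qed.

Lemma fspan0 l : 0 \in fspan l.
Proof.
elim: l => [|x l IH]; first exact: mem_head.
by apply/fspan_consP; exists 0 => //; exists 0; rewrite // rmorph0 mul0r addr0.
Qed.

Lemma fspan_sub_neq0 l x v : x \notin fspan l -> v \in fspan l -> x + v != 0.
Proof.
by move=> xl /fspanN vl; apply: contraNneq xl => /(canRL (addrK _)) ->; rewrite add0r.
Qed.

Lemma fspan_uniq l : findep l -> uniq (fspan l).
Proof.
elim: l => [//|x l IH] /= /andP[xl /IH ul].
apply: allpairs_uniq => //; first exact: enum_uniq.
move=> [c u] [d v] /= /allpairsP[[c' u'] /= [_ u'l [-> ->]]].
move=> /allpairsP[[d' v'] /= [_ v'l [-> ->]]] e.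
case: (eqVneq c' d') e => [-> /addrI -> //|cd e].
have cd0 : c' - d' != 0 by rewrite subr_eq0.
case/negP: xl; have -> : x = io (c' - d')^-1 * (v' - u').
  rewrite fmorphV; apply: (canRL (mulKf _)); first by rewrite fmorph_eq0.
  rewrite rmorphB mulrBl; apply/eqP; rewrite subr_eq addrAC eq_sym subr_eq eq_sym.
  by rewrite e addrC.
by apply: fspanZ; apply: fspanD => //; apply: fspanN.
Qed.

Lemma sum_fspanZ l c (f : E -> E) : c != 0 ->
  \sum_(v <- fspan l) f (io c * v) = \sum_(v <- fspan l) f v.
Proof.
move=> c0; elim: l f => [|x l IH] f; first by rewrite !big_seq1 mulr0.
rewrite !big_fspan_cons [RHS](reindex_onto ( *%R c) ( *%R c^-1)) /=; last first.
  by move=> d _; rewrite mulVKf.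
apply: eq_big => [d|d _]; first by rewrite mulKf // eqxx.
rewrite -(IH (fun v => f (io (c * d) * x + v))); apply: eq_bigr => v _.
by rewrite mulrDr mulrA rmorphM.
Qed.

Lemma sum_fspanD l u (f : E -> E) : u \in fspan l ->
  \sum_(v <- fspan l) f (u + v) = \sum_(v <- fspan l) f v.
Proof.
elim: l u f => [|x l IH] u f.
  by rewrite !inE => /eqP ->; rewrite !big_seq1 addr0.
move=> /fspan_consP[c [u' u'l ->] _]; rewrite !big_fspan_cons.
rewrite [RHS](reindex_onto (+%R c) (fun d => d - c)) /=; last first.
  by move=> d _; rewrite addrC subrK.
apply: eq_big => [d|d _]; first by rewrite addrAC subrr add0r eqxx.
rewrite -(IH u' (fun v => f (io (c + d) * x + v))) //; apply: eq_bigr => v _.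
by rewrite rmorphD mulrDl addrACA.
Qed.

(* For [l = [:: x_(d-1); ...; x_0]] this is the analogue of S_{<d}, where
   [g [:: x_(k-1); ...; x_0] x_k a] stands for S_k(a). *)
Fixpoint msum (g : seq E -> E -> nat -> E) l (s : seq nat) : E :=
  match l, s with
  | _, [::] => 1
  | [::], _ :: _ => 0
  | x :: l', a :: s' => msum g l' s + g l' x a * msum g l' s'
  end.

Lemma msum_nil g l : msum g l [::] = 1. Proof. by case: l. Qed.

(** With x = theta^k and [l] the lower powers of theta, x + v runs over the monic polynomials of
    degree k, so this is S_k(a); as S_k(1) = 1 / l_k, [lpow] is then 1 / l_k^a. *)
Definition psum l x (a : nat) : E := \sum_(v <- fspan l) (x + v) ^- a.
Definition lpow l x (a : nat) : E := psum l x 1 ^+ a.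

Lemma natr_card_finField : #|F|%:R = 0 :> F.
Proof.
have : \sum_(z : F) (z + 1) = \sum_(z : F) z.
  rewrite [RHS](reindex_onto (fun z => z + 1) (fun z => z - 1)) => [|z _].
    by apply: eq_bigl => z; rewrite addrK eqxx.
  by rewrite subrK.
by rewrite big_split /= sumr_const => /(canRL (addKr _)); rewrite addNr.
Qed.

(** If q - 1 divides i, there are q - 1 terms equal to 1; otherwise multiplication by some z with
    z^i different from 1 permutes the terms and forces the sum to vanish. *)
Lemma sum_unit_expV i : (0 < i)%N ->
  \sum_(c : F | c != 0) io c ^- i = - (#|F|.-1 %| i)%:R.
Proof.
move=> i0; under eq_bigr do rewrite -rmorphXn -fmorphV.
have q1 := finNzRing_gt1 F.
have cN0 (c : F) : c != 0 -> c ^+ #|F|.-1 = 1.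
  by move=> c0; apply: (mulfI c0); rewrite -exprS prednK ?expf_card ?mulr1 // ltnW.
rewrite -rmorph_sum /= -(rmorph_nat io) -rmorphN; congr (io _).
case: (boolP (_ %| _)%N) => [/dvdnP[k ->]|qi].
  rewrite (eq_bigr (fun=> 1)) => [|c c0]; last by rewrite mulnC exprM cN0 // expr1n invr1.
  have -> : \sum_(c : F | c != 0) 1 = (\sum_(c : F) 1) - 1 :> F.
    rewrite [X in _ = X - _](bigD1 0) //=.
    by rewrite addrAC subrr add0r.
  by rewrite sumr_const natr_card_finField sub0r.
suff [z z0 zi] : exists2 z : F, z != 0 & z ^- i != 1.
  rewrite oppr0; set S := \sum_(c | _) _; apply/eqP.
  have : (z ^- i - 1) * S == 0; last by rewrite mulf_eq0 subr_eq0 (negbTE zi).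
  rewrite mulrBl mul1r subr_eq0 mulr_sumr [X in _ == X](reindex_onto ( *%R z) ( *%R z^-1)) /=.
    apply/eqP/eq_big => [c|c _]; first by rewrite mulKf // eqxx andbT mulf_eq0 (negbTE z0).
    by rewrite exprMn invfM.
  by move=> c _; rewrite mulVKf.
(* Only i modulo q - 1 matters, and X^r - 1 with 0 < r < q - 1 cannot vanish at all q - 1 units. *)
have r0 : (0 < i %% #|F|.-1)%N by rewrite lt0n; move: qi; rewrite /dvdn.
set r := (i %% _)%N in r0.
have rq : (r < #|F|.-1)%N by rewrite ltn_mod -subn1 subn_gt0.
have [/existsP[z /andP[z0 zr]]|/existsPn H] := boolP [exists z : F, (z != 0) && (z ^+ r != 1)].
  exists z => //; rewrite (divn_eq i #|F|.-1) exprD mulnC exprM cN0 // expr1n mul1r.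
  by rewrite invr_eq1.
have := @max_poly_roots _ ('X^r - 1 : {poly F}) (enum (predC1 (0%R : F))).
rewrite -size_poly_eq0 size_XnsubC // => /(_ isT) h.
have : (size (enum (predC1 (0%R : F))) < r.+1)%N.
  apply: h; last exact: enum_uniq.
  apply/allP => z; rewrite mem_enum inE => z0; rewrite rootE !hornerE.
  by have := H z; rewrite z0 /= negbK subr_eq0.
by rewrite -cardE cardC1 ltnS leqNgt rq.
Qed.

(** Each nonzero v is uniquely a scalar times an element with leading coefficient 1. The latter
    contribute [msum psum l [:: i]]; the scalars contribute their power sum, the source of the
    divisibility condition in [Delta]. *)
Lemma sum_fspan_expV l i : findep l -> (0 < i)%N ->
  \sum_(v <- fspan l | v != 0) v ^- i
    = if (#|F|.-1 %| i)%N then - msum psum l [:: i] else 0.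
Proof.
move=> fl i0.
have expV0 v : v = 0 -> v ^- i = 0 by move=> ->; rewrite expr0n gtn_eqF // invr0.
(* The inverse of 0 is 0, so for i > 0 the term v = 0 can be added. *)
have -> : \sum_(v <- fspan l | v != 0) v ^- i = \sum_(v <- fspan l) v ^- i.
  by rewrite big_mkcond; apply: eq_bigr => v _; case: eqVneq => [/expV0|].
elim: l fl => [_|x l IH /andP[xl fl]].
  by rewrite big_seq1 expV0 //= oppr0 if_same.
rewrite big_fspan_cons (bigD1 0) //=.
under eq_bigr do rewrite rmorph0 mul0r add0r.
rewrite IH // msum_nil mulr1.
have -> : \sum_(c : F | c != 0) \sum_(v <- fspan l) (io c * x + v) ^- i
    = \sum_(c : F | c != 0) io c ^- i * psum l x i.
  apply: eq_bigr => c c0; rewrite -(sum_fspanZ _ _ c0) mulr_sumr.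
  by apply: eq_bigr => v _; rewrite -mulrDr exprMn invfM.
rewrite -mulr_suml sum_unit_expV //; case: ifP => _; last by rewrite oppr0 mul0r addr0.
by rewrite opprD mulN1r.
Qed.

End Span.

(** * Partial fractions with two poles *)

Section PartialFractions.
Variable E : fieldType.
Implicit Types (A B D : E).

(* The coefficient binomial(i - 1, b - 1), continued to 1 at i = b = 0 and to 0
   at the other boundary values, so that [pfcoefS] has no exceptions. *)
Definition pfcoef (b i : nat) : nat :=
  match b, i with
  | 0, 0 => 1
  | 0, _ => 0
  | _, 0 => 0
  | b'.+1, i'.+1 => 'C(i', b')
  end.

Lemma pfcoefS b i : pfcoef b.+1 i.+1 = (pfcoef b.+1 i + pfcoef b i)%N.
Proof. by case: b i => [|b] [|i] //=; rewrite ?bin0 ?addn0 // binS. Qed.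

Lemma pfcoef_small b i : (i < b)%N -> pfcoef b i = 0%N.
Proof. by case: b i => [|b] [|i] //= ib; rewrite bin_small. Qed.

(** The polar part at A = 0 of 1 / (A^a B^b), where B = A - D and D is fixed. The sign (-1)^b
    becomes the (-1)^(b-1) of [Delta] through the minus sign in [sum_fspan_expV]. *)
Definition pfpart a b A D : E :=
  \sum_(i < a + b) (-1) ^+ b * (pfcoef b i)%:R * D ^- i * A ^- (a + b - i).

Lemma pfpartS a b A D : D != 0 ->
  pfpart a.+1 b.+1 A D = D^-1 * (pfpart a b.+1 A D - pfpart a.+1 b A D).
Proof.
move=> D0; rewrite /pfpart addSn addnS big_ord_recl mulr0 !mul0r add0r.
rewrite -sumrB mulr_sumr; apply: eq_bigr => i _.
rewrite pfcoefS subSS natrD exprS [D ^+ _.+1]exprS invfM; ring.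
Qed.

Lemma pfpart0l b A D : pfpart 0 b A D = 0.
Proof.
rewrite /pfpart big1 // => i _.
by rewrite pfcoef_small ?mulr0 ?mul0r.
Qed.

Lemma pfpart0r a A D : (0 < a)%N -> pfpart a 0 A D = A ^- a.
Proof.
case: a => // a _; rewrite /pfpart addn0 big_ord_recl big1 => [|i _] /=.
  by rewrite !expr0 invr1 !mul1r subn0 addr0.
by rewrite mulr0 !mul0r.
Qed.

(** Induction on a + b by 1 / (A B) = (1 / B - 1 / A) / (A - B); Pascal's rule gives [pfpart] the
    same recursion. *)
Lemma partial_fraction a b A B : A != 0 -> B != 0 -> A - B != 0 ->
  (0 < a + b)%N ->
  A ^- a * B ^- b = pfpart a b A (A - B) + pfpart b a B (B - A).
Proof.
move=> A0 B0 D0; have D0' : B - A != 0 by rewrite -opprB oppr_eq0.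
have [n] := ubnP (a + b)%N; elim: n => // n IH in a b *.
case: a b => [|a] [|b] //.
- by move=> _ _; rewrite pfpart0l pfpart0r // expr0 invr1 mul1r add0r.
- by move=> _ _; rewrite pfpart0l pfpart0r // expr0 invr1 mulr1 addr0.
move=> abn _; rewrite !pfpartS //.
have -> : A ^- a.+1 * B ^- b.+1
    = (A - B)^-1 * (A ^- a * B ^- b.+1 - A ^- a.+1 * B ^- b).
  by rewrite !exprS; field; rewrite D0 A0 B0 !expf_neq0.
rewrite !IH ?addnS //; try by move: abn; rewrite ?addSn ?addnS; lia.
have -> : (B - A)^-1 = - (A - B)^-1 by rewrite -invrN opprB.
ring.
Qed.

End PartialFractions.

(** * The product formula for power sums of an independent family *)

Section PowerSumProduct.
Variables (F : finFieldType) (E : fieldType) (io : {rmorphism F -> E}).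
Implicit Types (l : seq E) (x u v w : E).
Local Notation q := #|F|.
Local Notation fspan := (fspan io).
Local Notation psum := (psum io).
Local Notation lpow := (lpow io).
Local Notation findep := (findep io).

Lemma sum_fspan_pfpart l x a b : findep l -> (0 < b)%N ->
  \sum_(u <- fspan l) \sum_(w <- fspan l | w != 0) pfpart a b (x + u) w
    = \sum_(1 <= i < a + b)
        (if (q.-1 %| i)%N then (-1) ^+ b.-1 * 'C(i.-1, b.-1)%:R else 0)
        * (psum l x (a + b - i) * msum psum l [:: i]).
Proof.
move=> fl b0; under eq_bigr do rewrite exchange_big /=.
rewrite exchange_big /= -(big_mkord xpredT (fun i => \sum_(u <- fspan l)
  \sum_(w <- fspan l | w != 0)
    (-1) ^+ b * (pfcoef b i)%:R * w ^- i * (x + u) ^- (a + b - i))).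
rewrite big_ltn ?addn_gt0 ?b0 ?orbT // big1 ?add0r; last first.
  by move=> u _; rewrite big1 // => w _; case: b b0 => // b _; rewrite mulr0 !mul0r.
apply: eq_big_nat => i /andP[i0 _].
under eq_bigr do rewrite -mulr_suml -mulr_sumr.
rewrite -mulr_sumr sum_fspan_expV //; case: ifP => _; last by rewrite mulr0 !mul0r.
case: b b0 i i0 => // b _ [//|i] _ /=; rewrite exprS; rewrite /psum; ring.
Qed.

(** The diagonal of the double sum gives the exponent a + b. Off the diagonal v = u + w with w
    nonzero, and partial fractions with A - B = -w decouple u from w. *)
Lemma psumM l x a b : findep (x :: l) -> (0 < a)%N -> (0 < b)%N ->
  psum l x a * psum l x b = psum l x (a + b)
    + \sum_(1 <= i < a + b)
        (if (q.-1 %| i)%N then (-1) ^+ a.-1 * 'C(i.-1, a.-1)%:R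
                               + (-1) ^+ b.-1 * 'C(i.-1, b.-1)%:R else 0)
        * (psum l x (a + b - i) * msum psum l [:: i]).
Proof.
move=> /= /andP[xl fl] a0 b0; rewrite mulr_suml.
transitivity (\sum_(u <- fspan l) ((x + u) ^- (a + b)
    + (\sum_(w <- fspan l | w != 0) pfpart a b (x + u) w
       + \sum_(w <- fspan l | w != 0) pfpart b a (x + (u + w)) w))).
  apply: eq_big_seq => u ul; rewrite mulr_sumr.
  rewrite -(@sum_fspanD _ _ _ l u (fun v => (x + u) ^- a * (x + v) ^- b)) //.
  rewrite (bigD1_seq 0) ?fspan0 ?fspan_uniq //= addr0 exprD invfM.
  congr (_ + _).
  (* The polar part at x + u comes with -w; the symmetry w -> -w of the span removes the sign. *)
  have -> : \sum_(w <- fspan l | w != 0) pfpart a b (x + u) w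
      = \sum_(w <- fspan l | w != 0) pfpart a b (x + u) (- w).
    rewrite big_mkcond /= -(@sum_fspanZ _ _ io l (-1)) ?oppr_eq0 ?oner_eq0 //.
    rewrite [RHS]big_mkcond; apply: eq_bigr => w _.
    by rewrite rmorphN1 mulN1r oppr_eq0.
  rewrite -big_split big_seq_cond [RHS]big_seq_cond; apply: eq_bigr => w /andP[wl w0].
  have nz := fspan_sub_neq0 xl; rewrite partial_fraction ?addn_gt0 ?a0 //.
  - by congr (pfpart _ _ _ _ + pfpart _ _ _ _); ring.
  - exact: nz.
  - by apply: nz; apply: fspanD.
  - by rewrite addrA opprD addrA subrr add0r oppr_eq0.
rewrite !big_split /=; congr (_ + _).
rewrite [X in _ + X]exchange_big /=.
(* Translating u by w, which permutes the span, removes w from the first argument. *)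
have -> : \sum_(w <- fspan l | w != 0) \sum_(u <- fspan l) pfpart b a (x + (u + w)) w
    = \sum_(u <- fspan l) \sum_(w <- fspan l | w != 0) pfpart b a (x + u) w.
  rewrite [RHS]exchange_big /= big_seq_cond [RHS]big_seq_cond.
  apply: eq_bigr => w /andP[wl _].
  rewrite -(@sum_fspanD _ _ io l w (fun v => pfpart b a (x + v) w)) //.
  by apply: eq_bigr => u _; rewrite [u + w]addrC.
rewrite !sum_fspan_pfpart // [(b + a)%N]addnC -big_split; apply: eq_bigr => i _ /=.
by case: ifP => _; rewrite -mulrDl ?addr0 // [in LHS]addrC.
Qed.

(** Induction on a, multiplying by S_d(1). A [Delta] term can occur only for i = q - 1, when the
    exponent reaches q, and its coefficient 1 + (-1)^(q-2) is 0 in E. *)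
Lemma psum_lpow l x a : findep (x :: l) -> (0 < a <= q)%N ->
  psum l x a = lpow l x a.
Proof.
move=> fx; elim: a => // a IH /andP[_ aq]; case: a IH aq => [|a] IH aq.
  by rewrite /lpow expr1.
rewrite /lpow exprS -[psum l x 1 ^+ a.+1]/(lpow l x a.+1) -IH ?(ltnW aq) //.
rewrite psumM // add1n big1_seq ?addr0 // => i; rewrite mem_index_iota => /andP[_ /andP[i0 ia]].
case: ifP; last by rewrite mul0r.
move=> /dvdnP[k ik]; have q1 : (1 < q)%N := finNzRing_gt1 F.
have {k ik} iq : i = q.-1.
  case: k ik => [|[|k]] ik; [by rewrite ik in i0|by rewrite ik mul1n|].
  by move: ia; rewrite ik; nia.
have aq' : a.+1 = q.-1 by lia.
rewrite iq aq' /= !bin0 binn expr0 !mul1r mulr1.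
suff -> : 1 + (-1) ^+ q.-1.-1 = 0 :> E by rewrite mul0r.
(* This identity treats odd q and characteristic 2 alike. *)
have : (-1) ^+ q = -1 :> F by rewrite expf_card.
rewrite -[in LHS](prednK (ltnW q1)) -[in LHS](@prednK q.-1) ?exprS; last by lia.
rewrite !mulN1r opprK => /(congr1 io); rewrite rmorphN1 rmorphXn rmorphN1 => ->.
by rewrite subrr.
Qed.

End PowerSumProduct.

(** * Linear extension of functions on words *)

Section FreegLift.
Variables (R : comNzRingType) (T : choiceType) (M : lmodType R).
Implicit Types (f h : T -> M) (P : {freeg T / R}).

HB.instance Definition _ f :=
  GRing.isZmodMorphism.Build {freeg T / R} M (fglift f) (lift_is_additive f).

Lemma fglift_scalable f : scalable (fglift f).
Proof.
move=> c P; rewrite -[P in RHS]freeg_sumE [c *: P]/(fgscale c P) /fgscale.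
rewrite !raddf_sum /=.
by apply: eq_bigr => s _; rewrite !liftU scalerA.
Qed.

HB.instance Definition _ f :=
  GRing.isScalable.Build R {freeg T / R} M *:%R (fglift f) (@fglift_scalable f).

Lemma fglift_sumE f P : fglift f P = \sum_(s <- dom P) coeff s P *: f s.
Proof.
rewrite -{1}[P]freeg_sumE linear_sum; apply: eq_bigr => s _.
by rewrite /= liftU.
Qed.

Lemma fglift1 f s : fglift f << s >> = f s.
Proof. by rewrite liftU scale1r. Qed.

Lemma eq_in_fglift f h P : (forall s, s \in dom P -> f s = h s) ->
  fglift f P = fglift h P.
Proof.
by move=> e; rewrite !fglift_sumE; apply: eq_big_seq => s sP; rewrite e.
Qed.

Lemma fgliftD f h P : fglift f P + fglift h P = fglift (fun s => f s + h s) P.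
Proof.
by rewrite !fglift_sumE -big_split; apply: eq_bigr => s _; rewrite scalerDr.
Qed.

End FreegLift.

Lemma linear_fglift (R : comNzRingType) (T : choiceType) (M N : lmodType R)
    (L : {linear M -> N}) (f : T -> M) (P : {freeg T / R}) :
  L (fglift f P) = fglift (L \o f) P.
Proof.
by rewrite !fglift_sumE linear_sum; apply: eq_bigr => s _; rewrite linearZ.
Qed.

Lemma fglift_id (R : comNzRingType) (T : choiceType) (P : {freeg T / R}) :
  fglift (fun s => << s >> : {freeg T / R}) P = P.
Proof.
rewrite fglift_sumE -[RHS]freeg_sumE; apply: eq_bigr => s _; apply/eqP/freeg_eqP => t.
by rewrite coeffZ !coeffU mul1r.
Qed.

Lemma fglift_coeff (R : comNzRingType) (T : choiceType) (f : T -> {freeg T / R}) P t :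
  coeff t (fglift f P) = fglift (fun s => coeff t (f s) : R^o) P.
Proof.
rewrite !fglift_sumE raddf_sum; apply: eq_bigr => s _; exact: coeffZ.
Qed.

Lemma fglift_exchange (R : comNzRingType) (T : choiceType) (M : lmodType R)
    (f : T -> T -> M) (P Q : {freeg T / R}) :
  fglift (fun s => fglift (f s) Q) P = fglift (fun t => fglift (f^~ t) P) Q.
Proof.
rewrite !fglift_sumE; under eq_bigr do rewrite fglift_sumE scaler_sumr.
rewrite exchange_big; apply: eq_bigr => t _; rewrite fglift_sumE scaler_sumr.
by apply: eq_bigr => s _; rewrite !scalerA mulrC.
Qed.

(** * Power sums separate words *)

Section Independence.
Variables (F : finFieldType) (E : fieldType) (io : {rmorphism F -> E}).
Hypothesis E_infinite : forall n, exists2 s : seq E, uniq s & (n < size s)%N.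
Implicit Types (l : seq E) (x u v w : E).
Local Notation fspan := (fspan io).
Local Notation findep := (findep io).

Lemma poly_vanish_outside (r : seq E) (p : {poly E}) :
  (forall x, x \notin r -> p.[x] = 0) -> p = 0.
Proof.
move=> pr; apply/eqP; apply: contraT => p0.
have [s us sz] := E_infinite (size p + size r).
have := @max_poly_roots _ p [seq x <- s | x \notin r] p0.
rewrite filter_uniq // => /(_ _ isT).
have -> : all (root p) [seq x <- s | x \notin r].
  by apply/allP => x; rewrite mem_filter => /andP[xr _]; apply/eqP/pr.
move=> /(_ isT); rewrite ltnNge => /negP[].
have : (size [seq x <- s | x \in r] <= size r)%N.
  apply: uniq_leq_size; first exact: filter_uniq.
  by move=> x; rewrite mem_filter => /andP[].
rewrite !size_filter => r1; rewrite -(leq_add2r (size r)).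
apply: leq_trans (ltnW sz) _; rewrite -(count_predC (mem r) s) addnC.
by rewrite leq_add2l.
Qed.

(* Multiplying by D ^ m clears the poles at [x = 0], and then only the term of
   largest index survives at [x = 0]. *)
Lemma pole_independence (r : seq E) (D : {poly E}) (N : nat -> {poly E})
    (g : E -> nat -> E) (c : nat -> E) m :
  D.[0] = 0 -> (forall a, (0 < a)%N -> (N a).[0] != 0) ->
  (forall x a, x \notin r -> g x a * D.[x] ^+ a = (N a).[x]) ->
  (forall x, x \notin r -> \sum_(1 <= a < m) c a * g x a = 0) ->
  forall a, (0 < a < m)%N -> c a = 0.
Proof.
move=> D0 N0 gD; elim: m => [|m IH] cg a; first by rewrite andbF.
case: (posnP m) => [->|m0]; first by case: a.
have cm : c m = 0.
  pose p := \sum_(1 <= a < m.+1) c a *: (N a * D ^+ (m - a)).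
  have p0 : p = 0.
    apply: (@poly_vanish_outside r) => x xr.
    transitivity (D.[x] ^+ m * \sum_(1 <= a < m.+1) c a * g x a).
      rewrite horner_sum mulr_sumr.
      apply: eq_big_nat => b /andP[b0 bm].
      rewrite hornerZ hornerM -gD // horner_exp -mulrA -exprD subnKC //.
      by rewrite mulrA mulrC.
    by rewrite cg // mulr0.
  have := congr1 (fun p => p.[0]) p0; rewrite horner_sum big_nat_recr //=.
  rewrite big_nat big1 => [|b /andP[b0 bm]].
    rewrite add0r subnn expr0 mulr1 hornerZ horner0 => /eqP.
    by rewrite mulf_eq0 (negbTE (N0 _ m0)) orbF => /eqP.
  by rewrite hornerZ hornerM horner_exp D0 expr0n subn_eq0 leqNgt bm /= !mulr0.
move=> /andP[a0]; rewrite ltnS leq_eqVlt => /orP[/eqP-> //|am].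
apply: IH; last by rewrite a0.
by move=> x xr; have := cg x xr; rewrite big_nat_recr //= cm mul0r addr0.
Qed.

Definition head_independent (g : seq E -> E -> nat -> E) : Prop :=
  forall l (c : nat -> E) m, findep l ->
  (forall x, x \notin fspan l -> \sum_(1 <= a < m) c a * g l x a = 0) ->
  forall a, (0 < a < m)%N -> c a = 0.

(** Together with [span_cofactor], denominator and numerator of the rational function x ->
    [psum l x a]. At x = 0 the denominator vanishes, since 0 lies in the span, while the numerator
    keeps just its summand v = 0. *)
Definition span_poly l : {poly E} := \prod_(v <- fspan l) ('X + v%:P).
Definition span_cofactor l a : {poly E} :=
  \sum_(v <- fspan l) \prod_(w <- fspan l | w != v) ('X + w%:P) ^+ a.

Lemma span_poly0 l : (span_poly l).[0] = 0.
Proof.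
rewrite horner_prod; apply/eqP; rewrite prodf_seq_eq0; apply/hasP.
by exists 0; [exact: fspan0|rewrite /= !hornerE].
Qed.

Lemma span_cofactor0 l a : findep l -> (0 < a)%N -> (span_cofactor l a).[0] != 0.
Proof.
move=> fl a0; rewrite horner_sum (bigD1_seq 0) ?fspan0 ?fspan_uniq //=.
rewrite [X in _ + X]big1 => [|v v0].
  rewrite addr0 horner_prod prodf_seq_neq0; apply/allP => w _; apply/implyP => w0.
  by rewrite horner_exp !hornerE expf_neq0.
rewrite horner_prod; apply/eqP; rewrite prodf_seq_eq0; apply/hasP.
exists 0; first exact: fspan0.
by rewrite eq_sym v0 horner_exp !hornerE expr0n gtn_eqF.
Qed.

Lemma psum_span_poly l x a : findep l -> x \notin fspan l ->
  psum io l x a * (span_poly l).[x] ^+ a = (span_cofactor l a).[x].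
Proof.
move=> fl xl; rewrite horner_sum mulr_suml; apply: eq_big_seq => v vl.
rewrite !horner_prod -prodrXl (bigD1_seq v) ?fspan_uniq //= mulrA.
rewrite !hornerE mulVf ?mul1r; last by rewrite expf_neq0 ?(fspan_sub_neq0 xl).
by apply: eq_bigr => w _; rewrite horner_exp !hornerE.
Qed.

Lemma head_independent_psum : head_independent (psum io).
Proof.
move=> l c m fl; apply: (@pole_independence _ (span_poly l) (span_cofactor l)).
- exact: span_poly0.
- by move=> a; apply: span_cofactor0.
- by move=> x a; apply: psum_span_poly.
Qed.

Lemma head_independent_lpow : head_independent (lpow io).
Proof.
move=> l c m fl.
apply: (@pole_independence _ (span_poly l) (fun a => span_cofactor l 1 ^+ a)).
- exact: span_poly0.
- by move=> a a0; rewrite horner_exp expf_neq0 // span_cofactor0.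
- by move=> x a xl; rewrite horner_exp -psum_span_poly // expr1 exprMn.
Qed.

Local Notation SS := {freeg (seq nat) / E}.

Definition ev (z : seq nat -> E) : SS -> E^o := fglift (z : seq nat -> E^o).
HB.instance Definition _ z := GRing.Linear.on (ev z).

Lemma ev1 z s : ev z << s >> = z s.
Proof. exact: (@fglift1 E _ E^o). Qed.

Lemma ev_lift (z : seq nat -> E) (f : seq nat -> SS) P :
  ev z (fglift f P) = ev (fun s => ev z (f s)) P.
Proof. exact: (linear_fglift (ev z)). Qed.

Lemma eq_in_ev z z' P : (forall s, s \in dom P -> z s = z' s) -> ev z P = ev z' P.
Proof. exact: (@eq_in_fglift E _ E^o). Qed.

Lemma evE z P : ev z P = \sum_(s <- dom P) coeff s P * z s.
Proof. exact: (@fglift_sumE E _ E^o). Qed.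

Definition strip (a : nat) : SS -> SS :=
  fglift (fun s => if s is b :: s' then if b == a then << s' >> else 0 else 0 : SS).

Lemma coeff_strip a s P : coeff s (strip a P) = coeff (a :: s) P.
Proof.
rewrite fglift_coeff; apply: (@eq_in_fglift E _ E^o) => -[|b t] _; first exact: coeff0.
by case: eqVneq => [->|ba]; rewrite ?coeff0 ?coeffU ?mul1r eqseq_cons ?eqxx ?(negbTE ba).
Qed.

Lemma msum_cons_strip (g : seq E -> E -> nat -> E) l x P m :
  (forall s, s \in dom P -> all (fun a => 0 < a < m)%N s) ->
  ev (msum g (x :: l)) P
    = ev (msum g l) P + \sum_(1 <= a < m) ev (msum g l) (strip a P) * g l x a.
Proof.
move=> Pm; under eq_bigr do rewrite ev_lift evE mulr_suml.
rewrite !evE exchange_big -big_split /=; apply: eq_big_seq => s /Pm.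
case: s => [_|b s /= /andP[/andP[b0 bm] _]].
  rewrite msum_nil big1 ?addr0 ?msum_nil // => a _.
  by rewrite raddf0 mulr0 mul0r.
rewrite (bigD1_seq b) ?mem_index_iota ?b0 ?iota_uniq //= eqxx ev1.
rewrite big1 => [|a ab]; last by rewrite eq_sym (negbTE ab) raddf0 mulr0 mul0r.
by rewrite addr0 mulrDr -mulrA [msum g l s * _]mulrC.
Qed.

(** Induction on the length of words. Adjoining x to [l] changes the value of P by a combination of
    the [g l x a] whose coefficients are the values of [strip a P] at [l]. Head independence kills
    these coefficients, so [strip a P] vanishes by induction. *)
Lemma msum_inj (g : seq E -> E -> nat -> E) P : head_independent g ->
  (forall s, s \in dom P -> all (fun a => 0 < a)%N s) ->
  (forall l, findep l -> ev (msum g l) P = 0) -> P = 0.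
Proof.
move=> gi; have [n] : exists n, forall s, s \in dom P -> (size s < n)%N.
  by exists (\max_(s <- dom P) size s).+1 => s sP; rewrite ltnS; apply: leq_bigmax_seq.
elim: n P => [|n IH] P Pn Ppos Pv; apply/eqP/freeg_eqP => s; rewrite coeff0.
  by apply: coeff_outdom; apply/negP => /Pn.
case: s => [|a s].
  (* On the empty family nonempty words have value 0, so the value of P is its coefficient at the
     empty word. *)
  rewrite -(Pv [::]) //; apply: (@eq_in_fglift E _ E^o) => -[|b t] _ //=.
case: (posnP a) => [->|a0].
  by apply: coeff_outdom; apply/negP => /Ppos.
rewrite -coeff_strip [strip a P]IH ?coeff0 // => [t|t|l fl].
- by rewrite mem_dom coeff_strip -mem_dom => /Pn; rewrite ltnS.
- by rewrite mem_dom coeff_strip -mem_dom => /Ppos /andP[].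
pose m := (maxn a (\max_(s <- dom P) \max_(b <- s) b)).+1.
apply: (gi l (fun a => ev (msum g l) (strip a P)) m) => // [x xl|]; last first.
  by rewrite a0 ltnS leq_maxl.
have Pm t : t \in dom P -> all (fun a => 0 < a < m)%N t.
  move=> tP; apply/allP => b bt; rewrite (allP (Ppos _ tP)) //=.
  rewrite ltnS leq_max; apply/orP; right.
  apply: leq_trans (@leq_bigmax_seq _ t xpredT (fun b : nat => b) _ bt isT) _.
  exact: (@leq_bigmax_seq _ _ xpredT (fun s : seq nat => \max_(b <- s) b) _ tP isT).
have := msum_cons_strip g l x Pm.
by rewrite !Pv ?add0r //= ?xl // => <-.
Qed.

End Independence.

(** * Power sums turn products of words into products of scalars *)

Section Words.
Variable F : finFieldType.
Local Notation K := {fraction {poly F}}.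
Local Notation SS := {freeg (seq nat) / K}.
Implicit Types (s t : seq nat) (P Q : SS) (l : seq K) (x : K).

Definition scalarK : {rmorphism F -> K} := @FracField.tofrac {poly F} \o polyC.

Lemma K_infinite n : exists2 r : seq K, uniq r & (n < size r)%N.
Proof.
exists [seq (theta F) ^+ i | i <- iota 0 n.+1]; last by rewrite size_map size_iota.
rewrite map_inj_uniq ?iota_uniq // => i j; rewrite /theta -!tofracXn.
move=> /eqP; rewrite tofrac_eq => /eqP /(congr1 (fun p : {poly F} => size p)).
by rewrite !size_polyXn => -[].
Qed.

Local Notation findep := (findep scalarK).
Local Notation psum := (psum scalarK).
Local Notation lpow := (lpow scalarK).

Definition supported (A : seq nat -> Prop) P : Prop := forall s, s \in dom P -> A s.

Lemma supported1 (A : seq nat -> Prop) s : A s -> supported A << s >>.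
Proof. by move=> As t; rewrite domU1 inE => /eqP->. Qed.

Lemma supported0 A : supported A 0.
Proof. by move=> s; rewrite dom0. Qed.

Lemma supportedD A P Q : supported A P -> supported A Q -> supported A (P + Q).
Proof. by move=> AP AQ s /domD_subset; rewrite mem_cat => /orP[/AP|/AQ]. Qed.

Lemma supportedZ A c P : supported A P -> supported A (c *: P).
Proof. by move=> AP s /domZ_subset /AP. Qed.

Lemma supportedB A P Q : supported A P -> supported A Q -> supported A (P - Q).
Proof. by move=> AP AQ; rewrite -scaleN1r; apply: supportedD => //; apply: supportedZ. Qed.

Lemma supported_sum A (I : eqType) (r : seq I) (p : pred I) (f : I -> SS) :
  (forall i, i \in r -> p i -> supported A (f i)) ->
  supported A (\sum_(i <- r | p i) f i).
Proof.
move=> Af; rewrite big_seq_cond; elim/big_rec: _ => [|i P /andP[ir pi] AP].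
  exact: supported0.
by apply: supportedD => //; apply: Af.
Qed.

Lemma supported_lift A (f : seq nat -> SS) P :
  (forall s, s \in dom P -> supported A (f s)) -> supported A (fglift f P).
Proof.
move=> Af; rewrite fglift_sumE; apply: supported_sum => s sP _.
by apply: supportedZ; apply: Af.
Qed.

Lemma supported_prepend (A B : seq nat -> Prop) a P :
  (forall s, B s -> A (a :: s)) -> supported B P -> supported A (prepend a P).
Proof.
by move=> BA BP; apply: supported_lift => s /BP /BA; apply: supported1.
Qed.

Lemma homogE w P : homog w P = supported (tuples w) P. Proof. by []. Qed.

Lemma tuples_cons w a s : (0 < a)%N -> tuples w s -> tuples (a + w) (a :: s).
Proof. by move=> a0 [s0 <-]; split; rewrite /= ?a0. Qed.

Lemma homog_prepend w v a P :
  (0 < a)%N -> homog w P -> v = (a + w)%N -> homog v (prepend a P).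
Proof. by move=> a0 hP ->; apply: supported_prepend hP => s; apply: tuples_cons. Qed.

Lemma prepend1 a s : prepend a << s >> = << a :: s >> :> SS.
Proof. exact: fglift1. Qed.

Lemma homog_starS_rec n v w s t :
  tuples v s -> tuples w t -> homog (v + w) (starS_rec F n s t).
Proof.
elim: n v w s t => [|n IH] v w [|a s] [|b t] vs wt;
  rewrite homogE; try by apply: supported1;
    first [by case: vs => _ <-|case: wt => _ <-; rewrite addn0].
- exact: supported0.
have [/andP[/= a0 s0] vE] := vs; have [/andP[/= b0 t0] wE] := wt.
have ts : tuples (sumn s) s by [].
have tt : tuples (sumn t) t by [].
apply: supportedD; [apply: supportedD; [apply: supportedD|]|].
- by apply: homog_prepend (IH _ _ _ _ ts wt) _ => //; rewrite -vE addnA.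
- by apply: homog_prepend (IH _ _ _ _ vs tt) _ => //; rewrite -wE /= addnCA.
- apply: homog_prepend (IH _ _ _ _ ts tt) _; first by rewrite addn_gt0 a0.
  by rewrite -vE -wE addnACA.
apply: supported_sum => i; rewrite mem_index_iota => /andP[i0 iab] _.
apply: supportedZ; apply: (@homog_prepend (i + (sumn s + sumn t))).
- by rewrite subn_gt0.
- apply: supported_lift => u /(IH _ _ _ _ ts tt) ut; apply: IH => //.
  by split; rewrite /= ?i0 ?addn0.
by rewrite -vE -wE /=; lia.
Qed.

Lemma homog_starS v w s t :
  tuples v s -> tuples w t -> homog (v + w) (starS F s t).
Proof. exact: homog_starS_rec. Qed.

Lemma homog_starSi v w s t :
  tuples v s -> tuples w t -> homog (v + w) (starSi F s t).
Proof.
elim: s t v w => [|a s IHs] t v w vs wt.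
  by case: vs => _ <-; rewrite homogE; case: t wt => [|b t]; apply: supported1.
elim: t w wt => [|b t IHt] w wt.
  by case: wt => _ <-; rewrite homogE addn0; apply: supported1.
have [/andP[/= a0 s0] vE] := vs; have [/andP[/= b0 t0] wE] := wt.
have ts : tuples (sumn s) s by [].
have tt : tuples (sumn t) t by [].
apply: supportedD; [apply: supportedD|].
- by apply: homog_prepend (IHs _ _ _ ts wt) _ => //; rewrite -vE addnA.
- by apply: homog_prepend (IHt _ tt) _ => //; rewrite -wE /= addnCA.
apply: homog_prepend (IHs _ _ _ ts tt) _; first by rewrite addn_gt0 a0.
by rewrite -vE -wE addnACA.
Qed.

(* The analogue of S_d, as opposed to S_{<d}. *)
Definition incr (g : seq K -> K -> nat -> K) l x : SS -> K^o :=
  ev (fun s => msum g (x :: l) s - msum g l s).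
HB.instance Definition _ g l x := GRing.Linear.on (incr g l x).

Lemma incrE g l x P : incr g l x P = ev (msum g (x :: l)) P - ev (msum g l) P.
Proof.
rewrite /incr !evE -sumrB; apply: eq_bigr => s _; exact: mulrBr.
Qed.

Lemma incr_prepend g l x a P :
  incr g l x (prepend a P) = g l x a * ev (msum g l) P.
Proof.
rewrite /incr /prepend ev_lift !evE mulr_sumr; apply: eq_bigr => s _.
by rewrite ev1 /= addrAC subrr add0r mulrCA.
Qed.

Lemma ev_nil g P : supported (fun s => s != [::]) P -> ev (msum g [::]) P = 0.
Proof. by move=> P0; rewrite evE big1_seq // => -[|a t] /= /P0 // _; rewrite mulr0. Qed.

Lemma incr1 g l x s : incr g l x << s >> = msum g (x :: l) s - msum g l s.
Proof. exact: ev1. Qed.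

Definition realizes (g : seq K -> K -> nat -> K) (star : seq nat -> seq nat -> SS) :=
  forall l s t, findep l -> all (fun a => 0 < a)%N s -> all (fun a => 0 < a)%N t ->
  ev (msum g l) (star s t) = msum g l s * msum g l t.

(* The products on words differ only in their diagonal part [C]. *)
Lemma realizes_of_diag g star (C : nat -> nat -> seq nat -> seq nat -> SS) :
  (forall t, star [::] t = << t >>) -> (forall s, star s [::] = << s >>) ->
  (forall a s b t, star (a :: s) (b :: t)
     = prepend a (star s (b :: t)) + prepend b (star (a :: s) t) + C a b s t) ->
  (forall a s b t, supported (fun s => s != [::]) (C a b s t)) ->
  (forall l x a s b t, findep (x :: l) ->
     (forall u v, all (fun a => 0 < a)%N u -> all (fun a => 0 < a)%N v ->
        ev (msum g l) (star u v) = msum g l u * msum g l v) ->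
     all (fun a => 0 < a)%N (a :: s) -> all (fun a => 0 < a)%N (b :: t) ->
     incr g l x (C a b s t) = g l x a * g l x b * (msum g l s * msum g l t)) ->
  realizes g star.
Proof.
move=> star0l star0r star_cons C0 gC; elim=> [|x l IH] s t.
  case: s => [|a s]; first by rewrite star0l ev1 mul1r.
  case: t => [|b t] _ _ _; first by rewrite star0r ev1 mulr1.
  rewrite star_cons ev_nil ?mul0r //; apply: supportedD => //.
  by apply: supportedD; apply: (@supported_prepend _ xpredT).
case: s => [|a s]; first by rewrite star0l ev1 mul1r.
case: t => [|b t]; first by rewrite star0r ev1 mulr1.
move=> fl sp tp; have fl' : findep l by case/andP: fl.
have [[_ s0] [_ t0]] := (andP sp, andP tp).
rewrite -[LHS](subrK (ev (msum g l) (star (a :: s) (b :: t)))) -incrE.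
rewrite IH // [in X in X + _]star_cons !raddfD /= !incr_prepend gC //; last first.
  by move=> *; apply: IH.
rewrite !IH //=; ring.
Qed.

Lemma realizes_starSi : realizes lpow (starSi F).
Proof.
apply: (@realizes_of_diag _ _ (fun a b s t => prepend (a + b) (starSi F s t))) => //.
- by case.
- by case.
- by move=> a s b t; apply: (@supported_prepend _ xpredT).
move=> l x a s b t fl IH /andP[_ s0] /andP[_ t0].
by rewrite incr_prepend IH // /lpow exprD.
Qed.

(** The diagonal part is the product formula [psumM] times the values of the two tails; the factor
    S_{<d}(i) is absorbed by the inner product with the word (i). *)
Lemma realizes_starS : realizes psum (starS F).
Proof.
apply: (@realizes_of_diag _ _ (fun a b s t => prepend (a + b) (starS F s t)
    + \sum_(1 <= i < a + b) Delta F a b i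
        *: prepend (a + b - i) (fglift (starS F [:: i]) (starS F s t)))).
- exact: starS_nil_l.
- exact: starS_nil_r.
- by move=> a s b t; rewrite starS_cons addrA.
- move=> a s b t; apply: supportedD; first exact: (@supported_prepend _ xpredT).
  apply: supported_sum => i _ _; apply: supportedZ.
  exact: (@supported_prepend _ xpredT).
move=> l x a s b t fl IH /andP[a0 s0] /andP[b0 t0].
rewrite raddfD raddf_sum /= incr_prepend IH // psumM // mulrDl.
congr (_ + _); rewrite mulr_suml; apply: eq_big_nat => i /andP[i0 iab].
rewrite linearZ /= incr_prepend ev_lift -!mulrA; congr (_ * (_ * _)).
(* The induction hypothesis for the smaller family applies to (i) and to each word of the inner
   product, whose letters are positive by homogeneity. *)
transitivity (ev (fun u => msum psum l [:: i] * msum psum l u) (starS F s t)).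
  apply: eq_in_ev => u us; rewrite IH //= ?i0 //.
  by have [] := homog_starS (conj s0 erefl) (conj t0 erefl) us.
rewrite -IH // !evE mulr_sumr; apply: eq_bigr => u _; exact: mulrCA.
Qed.

End Words.

(** * Values of the triangle and diamond products and of the operators *)

Section Operations.
Variable F : finFieldType.
Local Notation K := {fraction {poly F}}.
Local Notation SS := {freeg (seq nat) / K}.
Implicit Types (s t W : seq nat) (P Q : SS) (l : seq K) (x : K).
Local Notation findep := (findep (scalarK F)).
Local Notation psum := (psum (scalarK F)).
Local Notation lpow := (lpow (scalarK F)).
Local Notation positive := (all (fun a => 0 < a)%N).

(** What the S and the Si products have in common, so that the operators are evaluated for both
    kinds at once. *)
Record product_model (g : seq K -> K -> nat -> K) (star diam : seq nat -> seq nat -> SS)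
    : Prop := ProductModel {
  model_star : realizes g star;
  model_homog : forall v w s t, tuples v s -> tuples w t -> homog (v + w) (star s t);
  model_diam : forall a s b t, diam (a :: s) (b :: t)
    = star (a :: s) (b :: t) - prepend a (star s (b :: t)) - prepend b (star (a :: s) t)
}.

Lemma psum_model : product_model psum (starS F) (diamS F).
Proof.
by split=> [|v w s t|//]; [exact: realizes_starS|exact: homog_starS].
Qed.

Lemma lpow_model : product_model lpow (starSi F) (diamSi F).
Proof.
split=> [|v w s t|a s b t]; [exact: realizes_starSi|exact: homog_starSi|].
rewrite starSi_cons [diamSi _ _ _]/(prepend _ _).
set A := prepend a _; set B := prepend b _; set C := prepend (a + b) _.
by rewrite -[_ - A - B]addrA -opprD [A + B + C]addrC addrK.
Qed.

Lemma tuples_sumn s : positive s -> tuples (sumn s) s. Proof. by []. Qed.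

Lemma tuples_neq0 w s : (0 < w)%N -> tuples w s -> s != [::].
Proof. by case: s => // w0 [_ wE]; rewrite -wE in w0. Qed.

Section Model.
Variables (g : seq K -> K -> nat -> K) (star diam : seq nat -> seq nat -> SS).
Hypothesis gm : product_model g star diam.

Lemma homog_tri v w s t : (0 < v)%N -> tuples v s -> tuples w t ->
  homog (v + w) (tri star s t).
Proof.
move=> v0 vs wt; case: s vs (tuples_neq0 v0 vs) => // a s [/andP[a0 s0] <-] _.
apply: homog_prepend (model_homog gm (tuples_sumn s0) wt) _ => //.
by rewrite /= addnA.
Qed.

Lemma homog_diam v w s t : (0 < v)%N -> (0 < w)%N -> tuples v s -> tuples w t ->
  homog (v + w) (diam s t).
Proof.
move=> v0 w0 vs wt; case: s vs (tuples_neq0 v0 vs) => // a s vs _.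
case: t wt (tuples_neq0 w0 wt) => // b t wt _; rewrite (model_diam gm).
have [[/andP[a0 s0] vE] [/andP[b0 t0] wE]] := (vs, wt).
apply: supportedB; first apply: supportedB; first exact: (model_homog gm).
- apply: homog_prepend (model_homog gm (tuples_sumn s0) wt) _ => //.
  by rewrite -vE /= addnA.
- apply: homog_prepend (model_homog gm vs (tuples_sumn t0)) _ => //.
  by rewrite -wE /= addnCA.
Qed.

Lemma incr_tri l x s t : findep l -> s != [::] -> positive s -> positive t ->
  incr g l x (tri star s t) = incr g l x << s >> * msum g l t.
Proof.
case: s => // a s fl _ /andP[a0 s0] t0.
by rewrite incr_prepend (model_star gm) // incr1 /= addrAC subrr add0r mulrA.
Qed.

(** The increment of a product is two mixed terms plus the product of the increments, and the
    subtractions in the diamond product remove the mixed terms. The empty word must be excluded: its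
    increment is 0, yet it acts as the identity. *)
Lemma incr_diam l x s t : findep (x :: l) -> s != [::] -> t != [::] ->
  positive s -> positive t ->
  incr g l x (diam s t) = incr g l x << s >> * incr g l x << t >>.
Proof.
case: s t => // a s [//|b t] fl _ _ s0 t0; have fl' : findep l by case/andP: fl.
have [[_ s0'] [_ t0']] := (andP s0, andP t0).
rewrite (model_diam gm) !raddfB /= !incr_prepend incrE !(model_star gm) //.
rewrite !incr1 /=; ring.
Qed.

Lemma homog_ev z w P c (h : seq nat -> K) :
  homog w P -> (forall s, tuples w s -> z s = c * h s) -> ev z P = c * ev h P.
Proof.
move=> wP zh; rewrite !evE mulr_sumr; apply: eq_big_seq => s /wP ws.
by rewrite zh // mulrCA.
Qed.

Lemma incr_fglift l x (f : seq nat -> SS) P :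
  incr g l x (fglift f P) = ev (fun s => incr g l x (f s)) P.
Proof. exact: ev_lift. Qed.

Lemma incr_ev l x P : incr g l x P = ev (fun s => incr g l x << s >>) P.
Proof. by rewrite -incr_fglift fglift_id. Qed.

Variables (l : seq K) (x : K).
Hypothesis xl : findep (x :: l).

Let fl : findep l. Proof. by case/andP: xl. Qed.

Section OneWord.
Variables (n w : nat) (W : seq nat) (P : SS).
Hypotheses (n0 : (0 < n)%N) (nW : tuples n W) (w0 : (0 < w)%N) (wP : homog w P).

Let W0 : W != [::]. Proof. exact: tuples_neq0 nW. Qed.
Let Wp : positive W. Proof. by case: nW. Qed.
Let s0 s (ws : tuples w s) : s != [::]. Proof. exact: tuples_neq0 ws. Qed.
Let sp s (ws : tuples w s) : positive s. Proof. by case: ws. Qed.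

Lemma incr_lift_triL :
  incr g l x (fglift (tri star W) P) = incr g l x << W >> * ev (msum g l) P.
Proof.
rewrite incr_fglift; apply: (homog_ev wP) => s ws.
exact: incr_tri fl W0 Wp (sp ws).
Qed.

Lemma incr_lift_diamL :
  incr g l x (fglift (diam W) P) = incr g l x << W >> * incr g l x P.
Proof.
rewrite incr_fglift [X in _ * X]incr_ev.
apply: (homog_ev wP) => s ws; exact: incr_diam xl W0 (s0 ws) Wp (sp ws).
Qed.

Lemma incr_lift_triR :
  incr g l x (fglift (tri star ^~ W) P) = msum g l W * incr g l x P.
Proof.
rewrite incr_fglift [X in _ * X]incr_ev.
apply: (homog_ev wP) => s ws; rewrite mulrC; exact: incr_tri fl (s0 ws) (sp ws) Wp.
Qed.

Lemma incr_lift_diamR :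
  incr g l x (fglift (diam ^~ W) P) = incr g l x << W >> * incr g l x P.
Proof.
rewrite incr_fglift [X in _ * X]incr_ev.
apply: (homog_ev wP) => s ws; rewrite mulrC; exact: incr_diam xl (s0 ws) W0 (sp ws) Wp.
Qed.

End OneWord.

Section OneOperator.
Variables (n w : nat) (W : seq nat) (R : SS * SS).
Hypotheses (nW : tuples n W) (W0 : W != [::]) (w0 : (0 < w)%N).
Hypotheses (wP : homog w R.1) (wQ : homog w R.2).

Let n0 : (0 < n)%N.
Proof. by case: W W0 nW => // a s _ [/andP[a0 _] <-]; rewrite /= addn_gt0 a0. Qed.

(** Linearity in the increment of W is what allows W to be replaced by a combination of words. *)
Lemma incr_opB1 : incr g l x (opB star diam W R).1
  = incr g l x << W >> * (ev (msum g l) R.1 + incr g l x R.2 + ev (msum g l) R.2).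
Proof.
have -> : (opB star diam W R).1
  = fglift (tri star W) R.1 + fglift (diam W) R.2 + fglift (tri star W) R.2.
  by case: W W0.
rewrite !raddfD /= (incr_lift_triL n0 nW wP) (incr_lift_triL n0 nW wQ).
by rewrite (incr_lift_diamL n0 nW w0 wQ) !mulrDr.
Qed.

(** The first factor is S_{<d+1}(W). Together with [incr_opC2] at d + 1, this says that C_W
    multiplies the relation S_d(P) + S_{d+1}(Q) = 0 by S_{<d+1}(W). *)
Lemma incr_opC1 : incr g l x (opC star diam W R).1
  = (incr g l x << W >> + msum g l W) * incr g l x R.1.
Proof.
have -> : (opC star diam W R).1 = fglift (diam ^~ W) R.1 + fglift (tri star ^~ W) R.1.
  by case: W W0.
rewrite raddfD /= (incr_lift_triR nW w0 wP).
by rewrite (incr_lift_diamR n0 nW w0 wP) mulrDl.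
Qed.

Lemma incr_opC2 : incr g l x (opC star diam W R).2 = msum g l W * incr g l x R.2.
Proof.
have -> : (opC star diam W R).2 = fglift (tri star ^~ W) R.2 by case: W W0.
by rewrite (incr_lift_triR nW w0 wQ).
Qed.

End OneOperator.
End Model.

Section ModelHomog.
Variables (g : seq K -> K -> nat -> K) (star diam : seq nat -> seq nat -> SS).
Hypothesis gm : product_model g star diam.
Variables (n w : nat) (W : seq nat) (R : SS * SS).
Hypotheses (nW : tuples n W) (w0 : (0 < w)%N).
Hypotheses (wP : homog w R.1) (wQ : homog w R.2).

Lemma homog_opB : homog (n + w) (opB star diam W R).1 /\ homog (n + w) (opB star diam W R).2.
Proof.
case: W nW => [[_ <-] //|a s nas].
have n0 : (0 < n)%N by case: nas => /andP[a0 _] <-; rewrite addn_gt0 a0.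
split; last exact: supported0.
apply: supportedD; first apply: supportedD; apply: supported_lift => t.
- by move=> /wP wt; apply: (homog_tri gm).
- by move=> /wQ wt; apply: (homog_diam gm).
- by move=> /wQ wt; apply: (homog_tri gm).
Qed.

Lemma homog_opC : homog (n + w) (opC star diam W R).1 /\ homog (n + w) (opC star diam W R).2.
Proof.
case: W nW => [[_ <-] //|a s nas].
have n0 : (0 < n)%N by case: nas => /andP[a0 _] <-; rewrite addn_gt0 a0.
rewrite addnC; split; first apply: supportedD; apply: supported_lift => t.
- by move=> /wP wt; apply: (homog_diam gm).
- by move=> /wP wt; apply: (homog_tri gm).
- by move=> /wQ wt; apply: (homog_tri gm).
Qed.

End ModelHomog.
End Operations.

(** * From Si-type words to S-type words *)

Section Transfer.
Variable F : finFieldType.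
Local Notation q := #|F|.
Local Notation K := {fraction {poly F}}.
Local Notation SS := {freeg (seq nat) / K}.
Implicit Types (s t W : seq nat) (P Q : SS) (R : SS * SS) (l : seq K) (x : K).
Local Notation findep := (findep (scalarK F)).
Local Notation psum := (psum (scalarK F)).
Local Notation lpow := (lpow (scalarK F)).
Local Notation positive := (all (fun a => 0 < a)%N).
Local Notation triS := (tri (starS F)).

(* The [k + 1]-st power of the letter 1 for the diamond product. *)
Fixpoint one_pow (k : nat) : SS :=
  if k is k'.+1 then fglift (diamS F [:: 1%N]) (one_pow k') else << [:: 1%N] >>.

(* Since [S_d(1) = 1 / l_d], this rewrites Si-type sums as S-type sums. *)
Fixpoint phi1 s : SS :=
  if s is a :: s' then fglift (fun t => fglift (triS t) (phi1 s')) (one_pow a.-1)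
  else << [::] >>.

Definition phi : SS -> SS := fglift phi1.
HB.instance Definition _ := GRing.Linear.on phi.

Lemma homog_lift w v (f : seq nat -> SS) P :
  homog w P -> (forall s, tuples w s -> homog v (f s)) -> homog v (fglift f P).
Proof. by move=> wP vf; apply: supported_lift => s /wP /vf. Qed.

Lemma homog1 w s : tuples w s -> homog w (<< s >> : SS).
Proof. exact: supported1. Qed.

Lemma homog_one_pow k : homog k.+1 (one_pow k).
Proof.
elim: k => [|k IH]; first exact: homog1.
rewrite -add1n; apply: homog_lift IH _ => s; exact: (homog_diam (psum_model F)).
Qed.

Lemma homog_phi1 w s : tuples w s -> homog w (phi1 s).
Proof.
elim: s w => [|a s IH] w; first exact: homog1.
case=> /andP[a0 s0] <-; rewrite /= -[X in homog (X + _)](prednK a0).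
apply: homog_lift (@homog_one_pow _) _ => t ts.
apply: homog_lift (IH _ (tuples_sumn s0)) _ => u us.
exact: (homog_tri (psum_model F)).
Qed.

Lemma homog_phi w P : homog w P -> homog w (phi P).
Proof. by move=> wP; apply: homog_lift wP _ => s; apply: homog_phi1. Qed.

Lemma incr_one_pow l x k : findep (x :: l) ->
  incr psum l x (one_pow k) = lpow l x k.+1.
Proof.
move=> xl; elim: k => [|k IH].
  by rewrite incr1 /= !msum_nil !mulr1 addrAC subrr add0r /lpow expr1.
rewrite (incr_lift_diamL (psum_model F) xl (ltn0Sn 0) _ (ltn0Sn k) (@homog_one_pow k)) // IH.
rewrite incr1 /= !msum_nil mulr1 addrAC subrr add0r.
by rewrite /lpow [RHS]exprS.
Qed.

(** Induction on the family: the increment of phi(a, s) is S_d(1)^a times the value of phi(s) at the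
    smaller family, which is the recursion of the [lpow] sums. *)
Lemma ev_phi1 l s : findep l -> positive s ->
  ev (msum psum l) (phi1 s) = msum lpow l s.
Proof.
elim: l s => [|x l IH] [|a s] fl sp; try by rewrite ev1.
  rewrite ev_nil // => t /(homog_phi1 (tuples_sumn sp)); apply: tuples_neq0.
  by case/andP: sp => a0 _; rewrite addn_gt0 a0.
have /andP[_ fl'] := fl; have /andP[a0 s0] := sp.
rewrite -[LHS](subrK (ev (msum psum l) (phi1 (a :: s)))) -incrE IH //= addrC.
congr (_ + _); rewrite incr_fglift.
transitivity (ev (fun t => msum lpow l s * incr psum l x << t >>) (one_pow a.-1)).
  apply: eq_in_ev => t /homog_one_pow ts.
  rewrite (incr_lift_triL (psum_model F) fl _ ts (homog_phi1 (tuples_sumn s0))) //.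
  by rewrite IH // mulrC.
rewrite (homog_ev (@homog_one_pow a.-1) (fun _ _ => erefl)) -incr_ev.
by rewrite incr_one_pow // prednK // mulrC.
Qed.

Lemma ev_phi l w P : findep l -> homog w P ->
  ev (msum psum l) (phi P) = ev (msum lpow l) P.
Proof.
by move=> fl wP; rewrite ev_lift; apply: eq_in_ev => s /wP[sp _]; apply: ev_phi1.
Qed.

Lemma incr_phi l x w P : findep (x :: l) -> homog w P ->
  incr psum l x (phi P) = incr lpow l x P.
Proof. by move=> xl wP; rewrite !incrE !(ev_phi _ wP) //; case/andP: xl. Qed.

Lemma homog_inj g w P Q : head_independent (scalarK F) g -> homog w P -> homog w Q ->
  (forall l, findep l -> ev (msum g l) P = ev (msum g l) Q) -> P = Q.
Proof.
move=> gi wP wQ PQ; apply/eqP; rewrite -subr_eq0; apply/eqP.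
apply: (msum_inj gi) => [s|l fl].
  by have /(_ s) := supportedB wP wQ => h /h[].
by rewrite raddfB /= PQ // subrr.
Qed.

(** Words of positive weight have value 0 on the empty family, so increments determine all
    values. *)
Lemma homog_incr_inj w P Q : (0 < w)%N -> homog w P -> homog w Q ->
  (forall l x, findep (x :: l) -> incr psum l x P = incr psum l x Q) -> P = Q.
Proof.
move=> w0 wP wQ PQ; apply: (homog_inj (head_independent_psum (@K_infinite F)) wP wQ).
elim=> [_|x l IH xl].
  by rewrite !ev_nil // => s; [move/wQ|move/wP]; apply: tuples_neq0.
have /andP[_ fl] := xl; have := PQ l x xl; rewrite !incrE IH //.
by move/(congr1 (fun y => y + ev (msum psum l) Q)); rewrite !subrK.
Qed.

(** The [psum] values of phi(P) are the [lpow] values of P, and these separate words. *)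
Lemma phi_inj w P Q : homog w P -> homog w Q -> phi P = phi Q -> P = Q.
Proof.
move=> wP wQ e; apply: (homog_inj (head_independent_lpow (@K_infinite F)) wP wQ).
by move=> l fl; rewrite -(ev_phi fl wP) -(ev_phi fl wQ) e.
Qed.

(** For a at most q, S_d(a) = S_d(1)^a, so both sides have the same values. This covers the words
    (q) and (1, q - 1) of R_1. *)
Lemma phi1_small s : all (fun a => 0 < a <= q)%N s -> phi1 s = << s >>.
Proof.
move=> sq; have sp : positive s by apply: sub_all sq => a /andP[].
apply: (homog_inj (head_independent_psum (@K_infinite F))
  (homog_phi1 (tuples_sumn sp)) (homog1 (tuples_sumn sp))) => l fl.
rewrite ev_phi1 // ev1; elim: l s fl sq {sp} => [|x l IH] [|a s] //= fl /andP[aq sq].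
have /andP[_ fl'] := fl.
by rewrite !IH //= ?aq ?sq // -psum_lpow.
Qed.

Definition phi2 R : SS * SS := (phi R.1, phi R.2).

Section OneOperator.
Variables (n w : nat) (W : seq nat) (R : SS * SS).
Hypotheses (nW : tuples n W) (w0 : (0 < w)%N) (wP : homog w R.1) (wQ : homog w R.2).

(** Both sides are homogeneous of the same weight and have equal increments: the left one by
    transport along phi, the right one by linearity of [incr_opB1] in the word. *)
Lemma phi_opBSi :
  phi2 (opBSi W R) = (fglift (fun U => (opBS U (phi2 R)).1) (phi1 W),
                      fglift (fun U => (opBS U (phi2 R)).2) (phi1 W)).
Proof.
(* The operator of the empty word is the identity by convention and does not follow the general
   formula. *)
have [-> |W0] := eqVneq W [::]; first by rewrite !fglift1; case: R.
have [wP' wQ'] := (homog_phi wP, homog_phi wQ).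
have nl := homog_phi1 nW.
have nB : homog (n + w) (opBSi W R).1 := (homog_opB (lpow_model F) nW w0 wP wQ).1.
have U0 U : tuples n U -> U != [::].
  apply: tuples_neq0; case: nW => sp <-.
  by case: W W0 sp => // a s _ /andP[a0 _]; rewrite /= addn_gt0 a0.
congr pair; last first.
  rewrite fglift_sumE big1_seq => [|U /nl /U0].
    by rewrite (_ : _.2 = 0) ?raddf0 //; case: W W0.
  by case: U => // a s _; rewrite scaler0.
apply: (@homog_incr_inj (n + w)); first by rewrite addn_gt0 w0 orbT.
- exact: homog_phi.
- apply: homog_lift nl _ => U nU.
  by have [] := homog_opB (psum_model F) (R := phi2 R) nU w0 wP' wQ'.
move=> l x xl; have /andP[_ fl] := xl.
rewrite (incr_phi xl nB) (incr_opB1 (lpow_model F) xl nW W0 w0 wP wQ).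
rewrite incr_fglift mulrC -(ev_phi fl wP) -(ev_phi fl wQ) -(incr_phi xl wQ).
rewrite -(incr_phi xl (homog1 nW)) /phi fglift1 -/phi [incr _ _ _ (phi1 W)]incr_ev.
apply/esym/(homog_ev nl) => U nU.
by rewrite (incr_opB1 (psum_model F) (R := phi2 R) xl nU (U0 _ nU) w0 wP' wQ') mulrC.
Qed.

Lemma phi_opCSi :
  phi2 (opCSi W R) = (fglift (fun U => (opCS U (phi2 R)).1) (phi1 W),
                      fglift (fun U => (opCS U (phi2 R)).2) (phi1 W)).
Proof.
have [-> |W0] := eqVneq W [::]; first by rewrite !fglift1; case: R.
have [wP' wQ'] := (homog_phi wP, homog_phi wQ).
have nl := homog_phi1 nW.
have [nC1 nC2] := homog_opC (lpow_model F) nW w0 wP wQ.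
have U0 U : tuples n U -> U != [::].
  apply: tuples_neq0; case: nW => sp <-.
  by case: W W0 sp => // a s _ /andP[a0 _]; rewrite /= addn_gt0 a0.
congr pair; apply: (@homog_incr_inj (n + w)); rewrite ?addn_gt0 ?w0 ?orbT //.
- exact: homog_phi.
- apply: homog_lift nl _ => U nU.
  by have [] := homog_opC (psum_model F) (R := phi2 R) nU w0 wP' wQ'.
- move=> l x xl; have /andP[_ fl] := xl.
  rewrite (incr_phi xl nC1) (incr_opC1 (lpow_model F) xl nW W0 w0 wP).
  rewrite incr_fglift mulrC -(incr_phi xl wP).
  rewrite -(incr_phi xl (homog1 nW)) /phi fglift1 -/phi [incr _ _ _ (phi1 W)]incr_ev.
  rewrite -(ev_phi1 fl nW.1).
  have -> : ev (fun s => incr psum l x << s >>) (phi1 W) + ev (msum psum l) (phi1 W)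
      = ev (fun s => incr psum l x << s >> + msum psum l s) (phi1 W) :> K.
    by rewrite !evE -big_split; apply: eq_bigr => s _; rewrite mulrDr.
  apply/esym/(homog_ev nl) => U nU.
  by rewrite (incr_opC1 (psum_model F) (R := phi2 R) xl nU (U0 _ nU) w0 wP') mulrC.
- exact: homog_phi.
- apply: homog_lift nl _ => U nU.
  by have [] := homog_opC (psum_model F) (R := phi2 R) nU w0 wP' wQ'.
move=> l x xl; have /andP[_ fl] := xl.
rewrite (incr_phi xl nC2) (incr_opC2 (lpow_model F) xl nW W0 w0 wQ).
rewrite incr_fglift mulrC -(incr_phi xl wQ) -(ev_phi1 fl nW.1).
apply/esym/(homog_ev nl) => U nU.
by rewrite (incr_opC2 (psum_model F) (R := phi2 R) xl nU (U0 _ nU) w0 wQ') mulrC.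
Qed.

End OneOperator.

End Transfer.

(** * Surjectivity, and the spans of the generators *)

Section SpanTransfer.
Variable F : finFieldType.
Local Notation q := #|F|.
Local Notation K := {fraction {poly F}}.
Local Notation SS := {freeg (seq nat) / K}.
Implicit Types (s t U V : seq nat) (P Q X Y : SS).

Lemma diamS_one b t :
  diamS F [:: 1%N] (b :: t) = << (1 + b)%N :: t >>
    + \sum_(1 <= i < 1 + b) Delta F 1 b i
        *: prepend (1 + b - i) (fglift (starS F [:: i]) << t >>).
Proof.
rewrite /diamS starS_cons !starS_nil_l !prepend1.
set A := << 1%N :: _ >>; set B := prepend b _.
by rewrite -[_ - A - B]addrA -opprD -[A + B + _ + _]addrA addrAC subrr add0r.
Qed.

(** The [Delta] terms lower the first entry by i > 0; this is the origin of the triangularity of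
    phi. *)
Lemma diamS_one_head b t :
  supported (fun s => head 0%N s < 1 + b)%N (diamS F [:: 1%N] (b :: t) - << (1 + b)%N :: t >>).
Proof.
rewrite diamS_one addrC addKr; apply: supported_sum => i.
rewrite mem_index_iota => /andP[i0 ib] _; apply: supportedZ.
by apply: (@supported_prepend _ _ xpredT) => // s _ /=; rewrite ltn_subrL i0.
Qed.

Lemma one_pow_head k :
  supported (fun s => tuples k.+1 s /\ (head 0 s < k.+1)%N) (one_pow F k - << [:: k.+1] >>).
Proof.
have hk : homog k.+1 (<< [:: k.+1] >> : SS).
  by apply: homog1; split; rewrite //= addn0.
move=> s sP; split; first exact: (supportedB (@homog_one_pow F k) hk sP).
move: s sP {hk}; elim: k => [|k IH]; first by rewrite subrr => s; rewrite dom0.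
have -> : one_pow F k.+1 - << [:: k.+2] >>
  = fglift (diamS F [:: 1%N]) (one_pow F k - << [:: k.+1] >>)
    + (diamS F [:: 1%N] [:: k.+1] - << [:: k.+2] >>).
  by rewrite raddfB /= fglift1 addrA subrK.
apply: supportedD; last exact: diamS_one_head.
apply: supported_lift => -[|b t] tP; have bk := IH _ tP; first exact: supported1.
rewrite -[diamS _ _ _](subrK << (1 + b)%N :: t >>); apply: supportedD.
  by move=> s /diamS_one_head /leq_trans; apply; rewrite add1n ltnS ltnW.
exact: supported1.
Qed.

Definition in_phi w P := exists2 Q, homog w Q & phi Q = P.

Lemma in_phi_lift w (f : seq nat -> SS) P :
  (forall s, s \in dom P -> in_phi w (f s)) -> in_phi w (fglift f P).
Proof.
move=> fw; rewrite fglift_sumE big_seq; elim/big_rec: _ => [|s X sP [Q wQ <-]].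
  by exists 0; [exact: supported0|rewrite raddf0].
have [Q' wQ' <-] := fw s sP; exists (coeff s P *: Q' + Q).
  by apply: supportedD => //; apply: supportedZ.
by rewrite linearP.
Qed.

Lemma in_phi_supported w P : supported (fun s => in_phi w << s >>) P -> in_phi w P.
Proof. by move=> Pw; rewrite -[P]fglift_id; apply: in_phi_lift. Qed.

(** Induction on the weight and, within it, on the first entry. If phi(P) = s, then phi(a, P) is (a,
    s) plus words with first entry below a, because [one_pow] of index a - 1 is (a) up to such
    words. *)
Lemma phi_onto_tuples w s : tuples w s -> in_phi w << s >>.
Proof.
have [n] := ubnP w; elim: n => // n IHw in w s *; rewrite ltnS => wn.
have [m] := ubnP (head 0 s)%N; elim: m => // m IHa in s *; rewrite ltnS => am ws.
case: s am ws => [|a s] /= am ws.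
  by exists << [::] >>; [exact: homog1|rewrite /phi fglift1].
have [/andP[a0 s0] wE] := ws.
have lt_s : (sumn s < n)%N by apply: leq_trans wn; rewrite -wE /= -add1n leq_add2r.
have [P sP sE] := IHw _ _ lt_s (tuples_sumn s0).
have aw : homog w (prepend a P) by apply: homog_prepend sP _ => //; rewrite -wE.
have e : phi (prepend a P) = << a :: s >>
    + fglift (fun t => tri (starS F) t s) (one_pow F a.-1 - << [:: a.-1.+1] >>).
  rewrite raddfB /= fglift1 /= starS_nil_l prepend1 prednK // addrC subrK.
  rewrite /phi /prepend (linear_fglift (fglift (@phi1 F))).
  transitivity (fglift (fun u =>
      fglift (fun t => fglift (tri (starS F) t) (phi1 F u)) (one_pow F a.-1)) P).
    by apply: eq_in_fglift => u _; exact: fglift1.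
  (* With the sum over P innermost, phi(P) = s can be inserted. *)
  rewrite fglift_exchange; apply: eq_in_fglift => t _.
  rewrite -[LHS]linear_fglift -[fglift _ P]/(phi P) sE; exact: fglift1.
have -> : << a :: s >> = phi (prepend a P)
    - fglift (fun t => tri (starS F) t s) (one_pow F a.-1 - << [:: a.-1.+1] >>).
  by rewrite e addrK.
have [Q wQ <-] : in_phi w (fglift (fun t => tri (starS F) t s)
    (one_pow F a.-1 - << [:: a.-1.+1] >>)).
  apply: in_phi_lift => t /one_pow_head[ta th]; apply: in_phi_supported.
  have tw : homog w (tri (starS F) t s).
    rewrite -wE /= -[a in homog (a + _)](prednK a0).
    exact: (homog_tri (psum_model F) _ ta (tuples_sumn s0)).
  move=> u ut; apply: IHa (tw _ ut); apply: leq_trans am.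
  case: t ta th ut {tw} => [[_ //]|b t] _ /=; rewrite prednK // => ba.
  have : supported (fun u => head 0 u = b)%N (prepend b (starS F t s)).
    exact: (@supported_prepend _ _ xpredT).
  by move=> /[apply] ->.
exists (prepend a P - Q); first exact: supportedB.
by rewrite raddfB.
Qed.

Lemma phi_onto w P : homog w P -> in_phi w P.
Proof. by move=> wP; apply: in_phi_supported => s /wP; apply: phi_onto_tuples. Qed.

Lemma phi_small s : all (fun a => 0 < a <= q)%N s -> phi (<< s >> : SS) = << s >>.
Proof. by move=> sq; rewrite -[RHS]phi1_small //; apply: fglift1. Qed.

Lemma phi2_R1 : phi2 (R1 F) = R1 F.
Proof.
have q1 : (1 < q)%N := finNzRing_gt1 F.
rewrite /phi2 /R1 /= linearZ /= !phi_small //=.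
  by rewrite (ltnW q1) leq_pred -subn1 subn_gt0 q1.
by rewrite leqnn (ltnW q1).
Qed.

Lemma homog_R1 : homog q (R1 F).1 /\ homog q (R1 F).2.
Proof.
have q1 : (1 < q)%N := finNzRing_gt1 F.
split; [|apply: supportedZ]; apply: homog1; split; rewrite /= ?addn0 ?andbT.
- exact: ltnW.
- by [].
- by rewrite -subn1 subn_gt0.
- by rewrite add1n prednK // ltnW.
Qed.

Section Generators.
Variables star diam : seq nat -> seq nat -> SS.

Definition genBC U V : SS := overline (opB star diam U (opC star diam V (R1 F))).

Definition generators n : set SS :=
  [set P | exists (l m : nat) (U V : seq nat),
     [/\ tuples l U, tuples m V, (l + m = n)%N & P = genBC U V]].

(* An empty word acts as the identity, so the first two families are special
   cases of the third. *)
Lemma generatorsE n :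
  [set overline (opB star diam U (R1 F)) | U in tuples n]
    `|` [set overline (opC star diam V (R1 F)) | V in tuples n]
    `|` generators n = generators n.
Proof.
apply/seteqP; split=> [P [[[U nU <-]|[V nV <-]]|//]|P]; last by right.
  by exists n, 0%N, U, [::]; split; rewrite ?addn0.
by exists 0%N, n, [::], V; split.
Qed.

Lemma overline_opB_lift U (f h : seq nat -> SS) P :
  overline (opB star diam U (fglift f P, fglift h P))
    = fglift (fun s => overline (opB star diam U (f s, h s))) P.
Proof.
case: U => [|a U]; rewrite /overline /=.
  exact: fgliftD.
rewrite addr0 !linear_fglift !fgliftD.
by apply: eq_in_fglift => s _; rewrite addr0.
Qed.

End Generators.

Lemma homog_generators g star diam n P :
  @product_model F g star diam -> generators star diam n P -> homog (q + n) P.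
Proof.
move=> gm [l [m [U [V [lU mV <- ->]]]]]; have [h1 h2] := homog_R1.
have q0 : (0 < q)%N := ltnW (finNzRing_gt1 F).
have [c1 c2] := homog_opC gm mV q0 h1 h2.
have mq : (0 < m + q)%N by rewrite addn_gt0 q0 orbT.
have [b1 b2] := homog_opB gm lU mq c1 c2.
by rewrite addnC -addnA; apply: supportedD.
Qed.

Local Notation genS := (genBC (starS F) (diamS F)).
Local Notation genSi := (genBC (starSi F) (diamSi F)).

(** Bilinear extension of the generators, since phi(U) and phi(V) are combinations of words. *)
Definition bigenS X Y : SS := fglift (fun U => fglift (genS U) Y) X.

Lemma phi_genSi l m U V : tuples l U -> tuples m V ->
  phi (genSi U V) = bigenS (phi1 F U) (phi1 F V).
Proof.
move=> lU mV; have [h1 h2] := homog_R1.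
have q0 : (0 < q)%N := ltnW (finNzRing_gt1 F).
have [c1 c2] := homog_opC (lpow_model F) mV q0 h1 h2.
have mq : (0 < m + q)%N by rewrite addn_gt0 q0 orbT.
have eC := phi_opCSi mV q0 h1 h2; have eB := phi_opBSi lU mq c1 c2.
have -> : phi (genSi U V) = overline (phi2 (opBSi U (opCSi V (R1 F)))).
  exact: raddfD.
rewrite eB eC phi2_R1 /overline /=.
rewrite fgliftD; apply: eq_in_fglift => W _.
apply: (etrans (overline_opB_lift (starS F) (diamS F) W _ _ (phi1 F V))).
by apply: eq_in_fglift => Z _; rewrite /genBC -surjective_pairing.
Qed.

Lemma bigenS_phi X Y :
  bigenS (phi X) (phi Y)
    = fglift (fun U => fglift (fun V => bigenS (phi1 F U) (phi1 F V)) Y) X.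
Proof.
have lin f P : fglift f (phi P) = fglift (fun s => fglift f (phi1 F s)) P :> SS.
  exact: (linear_fglift (fglift f)).
rewrite [LHS]lin; apply: eq_in_fglift => U _.
rewrite fglift_exchange /bigenS.
under [RHS]eq_in_fglift do rewrite fglift_exchange.
exact: lin.
Qed.

Section LinSpan.
Variable G : set SS.

Lemma lin_span_gen P : G P -> lin_span G P.
Proof.
by move=> GP; exists 1%N, (fun=> 1), (fun=> P); split=> //; rewrite big_ord1 scale1r.
Qed.

Lemma lin_span0 : lin_span G 0.
Proof. by exists 0%N, (fun=> 0), (fun=> 0); split=> [[]|]; rewrite ?big_ord0. Qed.

Lemma lin_spanP c P Q : lin_span G P -> lin_span G Q -> lin_span G (c *: P + Q).
Proof.
move=> [m [d [g [Gg ->]]]] [m' [d' [g' [Gg' ->]]]].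
exists (m + m')%N, (fun i => match split i with inl j => c * d j | inr j => d' j end),
  (fun i => match split i with inl j => g j | inr j => g' j end).
split=> [i|]; first by case: split.
rewrite big_split_ord scaler_sumr; congr (_ + _); apply: eq_bigr => i _.
  by rewrite (unsplitK (inl i)) scalerA.
by rewrite (unsplitK (inr i)).
Qed.

Lemma lin_span_lift (f : seq nat -> SS) P :
  (forall s, s \in dom P -> lin_span G (f s)) -> lin_span G (fglift f P).
Proof.
move=> Gf; rewrite fglift_sumE big_seq; elim/big_rec: _ => [|s X sP GX].
  exact: lin_span0.
by apply: lin_spanP => //; apply: Gf.
Qed.

Lemma lin_span_ind (A : SS -> Prop) : A 0 ->
  (forall c P Q, G P -> A Q -> A (c *: P + Q)) -> forall P, lin_span G P -> A P.
Proof.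
move=> A0 AD P [m [c [g [Gg ->]]]]; elim/big_rec: _ => // i Q _; exact: AD.
Qed.

End LinSpan.

Local Notation spanS n := (lin_span (generators (starS F) (diamS F) n)).
Local Notation spanSi n := (lin_span (generators (starSi F) (diamSi F) n)).

Lemma phi_spanSi n P : spanSi n P -> spanS n (phi P).
Proof.
elim/lin_span_ind: P / => [|c _ Q [l [m [U [V [lU mV lm ->]]]]] sQ].
  by rewrite raddf0; apply: lin_span0.
rewrite linearP /=; apply: lin_spanP => //; rewrite (phi_genSi lU mV).
apply: lin_span_lift => U' /(homog_phi1 lU) lU'.
apply: lin_span_lift => V' /(homog_phi1 mV) mV'.
by apply: lin_span_gen; exists l, m, U', V'; split.
Qed.

(** U = phi(X) and V = phi(Y) with X, Y of the same weights; bilinearity spreads the generator of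
    (U, V) over images of the generators attached to the words of X and Y. *)
Lemma spanS_phi n P : spanS n P -> exists2 Q, spanSi n Q & phi Q = P.
Proof.
elim/lin_span_ind: P / => [|c _ P [l [m [U [V [lU mV lm ->]]]]] [Q sQ <-]].
  by exists 0; [exact: lin_span0|rewrite raddf0].
have [X lX XU] := phi_onto_tuples lU; have [Y mY YV] := phi_onto_tuples mV.
exists (c *: fglift (fun U => fglift (genSi U) Y) X + Q).
  apply: lin_spanP => //; apply: lin_span_lift => U' /lX lU'.
  apply: lin_span_lift => V' /mY mV'.
  by apply: lin_span_gen; exists l, m, U', V'; split.
rewrite linearP /=; congr (_ *: _ + _).
have -> : genS U V = bigenS (phi X) (phi Y).
  by rewrite XU YV /bigenS !fglift1.
rewrite bigenS_phi [LHS](linear_fglift (fglift (@phi1 F))).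
apply: eq_in_fglift => U' /lX lU'.
rewrite [LHS](linear_fglift (fglift (@phi1 F))).
by apply: eq_in_fglift => V' /mY mV'; apply: (phi_genSi lU' mV').
Qed.

Lemma homog_spanSi n P : spanSi n P -> homog (q + n) P.
Proof.
elim/lin_span_ind: P / => [|c P Q /(homog_generators (lpow_model F)) hP hQ].
  exact: supported0.
by apply: supportedD => //; apply: supportedZ.
Qed.

End SpanTransfer.

(** * Carlitz polynomials, and S_d(1) = 1 / l_d *)

Section CarlitzPoly.
Variables (F : finFieldType) (E : fieldType) (io : {rmorphism F -> E}).
Implicit Types (l : seq E) (x u v z : E).
Local Notation q := #|F|.
Local Notation fspan := (fspan io).
Local Notation findep := (findep io).
Local Notation psum := (psum io).

Lemma expDq u v : (u + v) ^+ q = u ^+ q + v ^+ q.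
Proof.
have [p pp pF] := finPcharP F; apply: exprDn_pchar.
rewrite (eq_pnat _ (fmorph_pchar io)) (eq_pnat _ (pcharf_eq pF)).
by have := pprimeChar_pgroup pF; rewrite /pgroup.pgroup cardsT.
Qed.

Lemma expNq u : (- u) ^+ q = - u ^+ q.
Proof.
have : (-1) ^+ q = -1 :> F by rewrite expf_card.
move/(congr1 io); rewrite rmorphXn !rmorphN1 => e.
by rewrite exprNn e mulN1r.
Qed.

Lemma exp_scalar c : io c ^+ q = io c.
Proof. by rewrite -rmorphXn expf_card. Qed.

Lemma sum_scalar_exp j : (j < q)%N -> \sum_(c : F) io c ^+ j = - (j == q.-1)%:R.
Proof.
have q1 : (1 < q)%N := finNzRing_gt1 F.
case: j => [_|j jq].
  under eq_bigr do rewrite expr0.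
  rewrite sumr_const -(rmorph_nat io) natr_card_finField rmorph0.
  by rewrite ltn_eqF ?oppr0 // -subn1 subn_gt0.
rewrite (bigD1 0) //= rmorph0 expr0n add0r.
rewrite (reindex_onto (fun c : F => c^-1) (fun c => c^-1)) /=; last by move=> c _; rewrite invrK.
under eq_bigl do rewrite invrK eqxx andbT invr_eq0.
under eq_bigr do rewrite fmorphV exprVn.
rewrite sum_unit_expV //; congr (- _%:R); congr nat_of_bool.
apply/idP/eqP => [/dvdn_leq|->//]; move=> /(_ isT).
by rewrite leq_eqVlt ltnNge -ltnS prednK ?(ltnW q1) // jq orbF eq_sym => /eqP.
Qed.

(** The logarithmic derivative of u^q - u. Dividing u^q - c^q by u - c and summing over c, only the
    powers c^(q-1) survive, and they add up to -1. *)
Lemma sum_scalar_inv u : (forall c, u - io c != 0) ->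
  (\sum_c (u - io c)^-1) * (u ^+ q - u) = -1.
Proof.
move=> u0; have q1 : (1 < q)%N := finNzRing_gt1 F.
transitivity (\sum_c ((\sum_(j < q) u ^+ (q.-1 - j) * io c ^+ j) - 1)).
  rewrite mulr_suml; apply: eq_bigr => c _.
  have -> : u ^+ q - u = (u - io c) * ((\sum_(j < q) u ^+ (q.-1 - j) * io c ^+ j) - 1).
    by rewrite mulrBr mulr1 -subrXX exp_scalar opprB addrA subrK.
  by rewrite mulKf.
rewrite sumrB sumr_const -(rmorph_nat io) natr_card_finField rmorph0 subr0.
rewrite exchange_big /=; under eq_bigr do rewrite -mulr_sumr sum_scalar_exp //.
have qE : q = q.-1.+1 by rewrite prednK // ltnW.
rewrite -(big_mkord xpredT (fun j => u ^+ (q.-1 - j) * - (j == q.-1)%:R)) qE /=.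
rewrite big_nat_recr //= subnn expr0 mul1r eqxx big1_seq ?add0r // => j.
by rewrite mem_index_iota => /= jq; rewrite ltn_eqF ?oppr0 ?mulr0.
Qed.

Fact vanish_ratio_step (B D G c : E) : B != 0 -> D != 0 -> G != 0 ->
  - G * c / (B * (G * D)) = c / D * (- B)^-1.
Proof. by move=> B0 D0 G0; field; rewrite oppr_eq0 B0 D0 G0. Qed.

(* [vanish l] is the product of the z - v over all v in [fspan l], computed by
   Moore's recursion, and [vanish_coef l] is its linear coefficient. *)
Fixpoint vanish l z : E :=
  if l is x :: l' then vanish l' z ^+ q - vanish l' x ^+ q.-1 * vanish l' z else z.

Fixpoint vanish_coef l : E :=
  if l is x :: l' then - vanish l' x ^+ q.-1 * vanish_coef l' else 1.

Lemma vanish_cons x l z :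
  vanish (x :: l) z = vanish l z ^+ q - vanish l x ^+ q.-1 * vanish l z.
Proof. by []. Qed.

Lemma vanish_linear l c u v :
  vanish l (io c * u + v) = io c * vanish l u + vanish l v.
Proof.
elim: l => //= x l ->; rewrite expDq exprMn exp_scalar; ring.
Qed.

Lemma vanish_span l v : v \in fspan l -> vanish l v = 0.
Proof.
have van0 l' : vanish l' 0 = 0.
  by have := vanish_linear l' (-1) 0 0; rewrite rmorphN1 mulr0 addr0 mulN1r addNr.
elim: l v => [|x l IH] v; first by rewrite inE => /eqP->.
move=> /fspan_consP[c [u ul ->] _] /=; rewrite vanish_linear (IH _ ul) addr0.
have q0 : (0 < q)%N := ltnW (finNzRing_gt1 F).
by rewrite exprMn exp_scalar -[in X in X - _](prednK q0) exprSr mulrCA subrr.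
Qed.

(** The logarithmic derivative of the additive polynomial [vanish l], whose derivative is the
    constant [vanish_coef l]. In the induction the span of [x :: l] is cut into translates by
    multiples of x, and [sum_scalar_inv] is applied to the quotient of the values at z and x. *)
Lemma psum1_vanish l z : findep (z :: l) ->
  vanish l z != 0 /\ psum l z 1 = vanish_coef l / vanish l z.
Proof.
elim: l z => [|x l IH] z /andP[zl fl].
  by rewrite /psum /= big_seq1 addr0 expr1 mul1r; move: zl; rewrite inE.
have /andP[xl fl'] := fl; have [x0 _] := IH x fl.
set X := vanish l x in x0; set Z := vanish l z.
have zc c : findep (io c * x + z :: l).
  apply/andP; split=> //; apply: contra zl => h; apply/fspan_consP.
  exists (- c) => //; exists (io c * x + z) => //.
  by rewrite rmorphN mulNr addrA addNr add0r.
have ZcX c : Z / X - io c != 0.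
  have [] := IH _ (zc (- c)); rewrite vanish_linear rmorphN -/X -/Z => h _.
  apply: contraNneq h => /(congr1 ( *%R^~ X)); rewrite mul0r mulrBl divfK // => <-.
  by rewrite mulNr addrC.
have q0 : (0 < q)%N := ltnW (finNzRing_gt1 F).
have vz : vanish (x :: l) z = X ^+ q * ((Z / X) ^+ q - Z / X).
  rewrite /= -/X -/Z expr_div_n mulrBr mulrCA divff ?mulr1 ?expf_neq0 //.
  by rewrite -[in X ^+ q * (Z / X)](prednK q0) exprSr; congr (_ - _); field.
have s1 := sum_scalar_inv ZcX.
have uu : (Z / X) ^+ q - Z / X != 0.
  by apply: contra_eq_neq s1 => ->; rewrite mulr0 eq_sym oppr_eq0 oner_eq0.
split; first by rewrite vz mulf_neq0 ?expf_neq0.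
transitivity (\sum_c psum l (io (- c) * x + z) 1).
  rewrite /psum big_fspan_cons (reindex_onto (fun c : F => - c) (fun c => - c)) /=.
    apply: eq_big => [c|c _]; first by rewrite opprK eqxx.
    by apply: eq_bigr => v _; rewrite addrCA addrA.
  by move=> c _; rewrite opprK.
transitivity (\sum_c vanish_coef l / X * (Z / X - io c)^-1).
  apply: eq_bigr => c _; have [_ ->] := IH _ (zc (- c)).
  rewrite vanish_linear rmorphN -/X -/Z -mulrA; congr (_ * _).
  by rewrite -invfM mulrBr [X * (Z / X)]mulrCA divff // mulr1 addrC mulNr [X * _]mulrC.
rewrite -mulr_sumr vz /= -/X.
rewrite -[\sum_c _](mulfK uu) s1.
have XqE : X ^+ q = X ^+ q.-1 * X by rewrite -exprSr prednK.
have X'0 : X ^+ q.-1 != 0 by rewrite expf_neq0.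
move: uu; set T := _ - _ => T0; rewrite XqE.
by field; rewrite T0 x0 X'0.
Qed.

End CarlitzPoly.

(** * The powers of theta and Carlitz's recursion *)

Section ThetaPowers.
Variable F : finFieldType.
Local Notation q := #|F|.
Local Notation K := {fraction {poly F}}.
Local Notation fspan := (fspan (scalarK F)).
Local Notation findep := (findep (scalarK F)).
Local Notation psum := (psum (scalarK F)).
Local Notation vanish := (@vanish F K).
Local Notation vanish_coef := (@vanish_coef F K).
Local Notation "x %:F" := (@FracField.tofrac _ x).
Local Notation theta := (theta F).

Fixpoint thetas (d : nat) : seq K :=
  if d is d'.+1 then theta ^+ d' :: thetas d' else [::].

Lemma scalarKE c : scalarK F c = c%:P%:F. Proof. by []. Qed.

Lemma mem_fspan_thetas d v :
  reflect (exists2 p : {poly F}, (size p <= d)%N & v = p%:F) (v \in fspan (thetas d)).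
Proof.
apply: (iffP idP) => [|[p]].
  elim: d v => [|d IH] v; first by rewrite inE => /eqP->; exists 0; rewrite ?size_poly0 ?tofrac0.
  move=> /fspan_consP[c [u /IH[p pd ->] ->] _]; exists (c *: 'X^d + p); last first.
    by rewrite tofracD -mul_polyC tofracM tofracXn.
  apply: leq_trans (size_polyD _ _) _; rewrite geq_max (leq_trans pd) // andbT.
  by apply: leq_trans (size_scale_leq _ _) _; rewrite size_polyXn.
elim: d v p => [|d IH] v p pd ->.
  by move: pd; rewrite leqn0 size_poly_eq0 => /eqP->; rewrite tofrac0 mem_head.
apply/fspan_consP; exists p`_d => //; exists (p - p`_d *: 'X^d)%:F; last first.
  by rewrite -tofracXn scalarKE -tofracM -tofracD mul_polyC addrC subrK.
apply: (IH _ (p - p`_d *: 'X^d)) => //; apply/leq_sizeP => j dj.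
rewrite coefB coefZ coefXn; case: eqVneq => [->|jd]; first by rewrite mulr1 subrr.
by rewrite mulr0 subr0 nth_default // (leq_trans pd) // ltn_neqAle eq_sym jd.
Qed.

Lemma findep_thetas d : findep (thetas d).
Proof.
elim: d => //= d ->; rewrite andbT; apply/mem_fspan_thetas => -[p pd].
rewrite /theta -tofracXn => /eqP; rewrite tofrac_eq => /eqP pE.
by move: pd; rewrite -pE size_polyXn ltnn.
Qed.

Lemma vanish_thetas_last d : vanish (thetas d.+1) (theta ^+ d) = 0.
Proof.
apply: (vanish_span (io := scalarK F)); apply/mem_fspan_thetas; exists 'X^d.
  by rewrite size_polyXn.
by rewrite tofracXn.
Qed.

(* Carlitz's relation e_{d+1}(theta z) = theta e_{d+1}(z) + [d+1] e_d(z)^q. *)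
Lemma vanish_thetasM d z : vanish (thetas d.+1) (theta * z)
  = theta * vanish (thetas d.+1) z
    + (theta ^+ (q ^ d.+1) - theta) * vanish (thetas d) z ^+ q.
Proof.
elim: d z => [|d IH] z.
  by rewrite /= expr0 expr1n !mul1r exprMn expn1; ring.
have D1 := IH (theta ^+ d); rewrite vanish_thetas_last mulr0 add0r -exprS in D1.
set B := _ - theta in IH D1; set D := vanish (thetas d) _ in D1.
have q0 : (0 < q)%N := ltnW (finNzRing_gt1 F).
have EqE (y : K) : y ^+ q = y ^+ q.-1 * y by rewrite -exprSr prednK.
have expD := expDq (scalarK F); have expN := expNq (scalarK F).
(* With [k] = theta^(q^k) - theta, this reads [d+2] = [d+1]^q + [1]. *)
have B' : theta ^+ (q ^ d.+2) - theta = B ^+ q + theta ^+ q - theta.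
  by rewrite /B expD expN -exprM -expnSr subrK.
rewrite B' -[thetas d.+2]/(_ :: thetas d.+1) !(vanish_cons _ (theta ^+ d.+1) (thetas d.+1)) IH D1.
set A := vanish (thetas d.+1) z; set f := vanish (thetas d) z.
have AE : A = f ^+ q - D ^+ q.-1 * f by [].
have AqE : A ^+ q = (f ^+ q) ^+ q - (D ^+ q.-1) ^+ q * f ^+ q.
  by rewrite AE expD expN exprMn.
have DE : (B * D ^+ q) ^+ q.-1 = B ^+ q.-1 * (D ^+ q.-1) ^+ q.
  by rewrite exprMn -!exprM mulnC.
rewrite DE expD !exprMn.
have BqE := EqE B; move: AqE; set A' := A ^+ q; set f' := f ^+ q; set f'' := f' ^+ q.
set G := (D ^+ q.-1) ^+ q; set b := B ^+ q.-1 in BqE *; move=> ->; rewrite BqE.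
ring.
Qed.

(** Carlitz's recursion D_{d+1} = [d+1] D_d^q for the product D_d of the monic polynomials of degree
    d. *)
Lemma vanish_thetas_next d : vanish (thetas d.+1) (theta ^+ d.+1)
  = (theta ^+ (q ^ d.+1) - theta) * vanish (thetas d) (theta ^+ d) ^+ q.
Proof. by rewrite exprS vanish_thetasM vanish_thetas_last mulr0 add0r. Qed.

(** From d to d + 1 the ratio [vanish_coef] / [vanish] is divided by -[d+1], which is exactly the
    new factor theta - theta^(q^(d+1)) of l_{d+1}. *)
Lemma psum1_thetas d : psum (thetas d) (theta ^+ d) 1 = (ell F d)^-1.
Proof.
have vd k : vanish (thetas k) (theta ^+ k) != 0
    /\ psum (thetas k) (theta ^+ k) 1 = vanish_coef (thetas k) / vanish (thetas k) (theta ^+ k).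
  exact: psum1_vanish (findep_thetas k.+1).
rewrite (vd d).2; elim: d => [|d IH]; first by rewrite /ell big_nil expr0 mul1r.
have q0 : (0 < q)%N := ltnW (finNzRing_gt1 F).
have := (vd d.+1).1; rewrite vanish_thetas_next mulf_eq0 negb_or => /andP[B0 _].
have -> : ell F d.+1 = ell F d * (theta - theta ^+ (q ^ d.+1)).
  by rewrite /ell big_nat_recr.
rewrite [in RHS]invfM -IH.
rewrite -[vanish_coef (thetas d.+1)]/(- vanish (thetas d) (theta ^+ d) ^+ q.-1
  * vanish_coef (thetas d)).
have D0 := (vd d).1; set D := vanish (thetas d) _ in D0 *.
have DqE : D ^+ q = D ^+ q.-1 * D by rewrite -exprSr prednK.
have D'0 : D ^+ q.-1 != 0 by rewrite expf_neq0.
move: B0; set B := _ - _ => B0; have -> : theta - theta ^+ (q ^ d.+1) = - B by rewrite opprB.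
by rewrite DqE; exact: vanish_ratio_step B0 D0 D'0.
Qed.

End ThetaPowers.

(** * S_d and Si_d as generalized power sums *)

Section ChainSums.
Variable F : finFieldType.
Local Notation K := {fraction {poly F}}.
Local Notation fspan := (fspan (scalarK F)).
Local Notation psum := (psum (scalarK F)).
Local Notation lpow := (lpow (scalarK F)).
Local Notation "x %:F" := (@FracField.tofrac _ x).
Local Notation theta := (theta F).
Local Notation thetas := (thetas F).

Section Chains.
Variables (X : finType) (ok : pred X) (deg : X -> nat) (h : X -> nat -> K).

(** The common shape of [Ssum], with polynomials as letters, and [Sisum], with indices as
    letters. *)
Definition tuple_sum (C : pred (seq X)) (s : seq nat) : K :=
  \sum_(a : (size s).-tuple X | C a) \prod_(i < size s) h (tnth a i) (nth 0%N s i).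

Lemma tuple_sum_nil C : tuple_sum C [::] = (C [::])%:R.
Proof.
rewrite /tuple_sum; under eq_bigr do rewrite big_ord0.
have [c|c] := boolP (C [::]); last by rewrite big_pred0 // => a; rewrite tuple0 (negbTE c).
by rewrite (big_pred1 [tuple]) // => a; rewrite [a]tuple0 c; apply/esym/eqP.
Qed.

Lemma tuple_sum_cons C b s :
  tuple_sum C (b :: s) = \sum_x h x b * tuple_sum (fun r => C (x :: r)) s.
Proof.
rewrite /tuple_sum; under [RHS]eq_bigr do rewrite mulr_sumr.
rewrite pair_big_dep /=.
rewrite (reindex (fun p : X * (size s).-tuple X => cons_tuple p.1 p.2)) /=; last first.
  exists (fun a => (thead a, behead_tuple a)) => [[x a] _|a _].
    by congr pair; apply: val_inj.
  by rewrite [RHS]tuple_eta; apply: val_inj.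
apply: eq_bigr => -[x a] _; rewrite big_ord_recl /=; congr (_ * _).
by apply: eq_bigr => i _; rewrite tnthS.
Qed.

Lemma eq_tuple_sum C C' s : C =1 C' -> tuple_sum C s = tuple_sum C' s.
Proof. by move=> e; apply: eq_bigl => a; apply: e. Qed.

Lemma tuple_sum_guard (b : bool) C s :
  tuple_sum (fun r => b && C r) s = if b then tuple_sum C s else 0.
Proof. by case: b => //; rewrite /tuple_sum big_pred0. Qed.

Definition below (d : nat) (r : seq X) : bool :=
  all ok r && path gtn d [seq deg x | x <- r].

Lemma msum_thetas g d b s : msum g (thetas d) (b :: s)
  = \sum_(k < d) g (thetas k) (theta ^+ k) b * msum g (thetas k) s.
Proof. by elim: d => [|d IH]; rewrite ?big_ord0 // big_ord_recr /= -IH. Qed.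

Variables (N : nat) (g : seq K -> K -> nat -> K).
Hypothesis gh : forall k b, (k < N)%N ->
  \sum_(x | ok x && (deg x == k)) h x b = g (thetas k) (theta ^+ k) b.

(** Sorting by the degree k of the first letter gives the expansion of [msum]. The bound N reflects
    that the finite type X only holds the letters of degree below N. *)
Lemma tuple_sum_below d s : (d <= N)%N -> tuple_sum (below d) s = msum g (thetas d) s.
Proof.
elim: s d => [|b s IH] d dN; first by rewrite tuple_sum_nil msum_nil.
rewrite tuple_sum_cons msum_thetas.
transitivity (\sum_x \sum_(k < d | ok x && (deg x == k)) h x b * msum g (thetas k) s).
  apply: eq_bigr => x _.
  rewrite (@eq_tuple_sum _ (fun r => (ok x && (deg x < d)%N) && below (deg x) r)); last first.
    by move=> r; rewrite /below /= -!andbA; congr (_ && _); rewrite andbCA.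
  rewrite tuple_sum_guard; case: (ok x) => /=; last by rewrite big_pred0 ?mulr0.
  case: ltnP => xd; last first.
    by rewrite big_pred0 ?mulr0 // => k; rewrite gtn_eqF // (leq_trans (ltn_ord k)).
  rewrite (big_pred1 (Ordinal xd)) ?IH ?(ltnW (leq_trans xd dN)) //.
rewrite (exchange_big_dep xpredT) //=; apply: eq_bigr => k _.
by rewrite -mulr_suml gh // (leq_trans (ltn_ord k)).
Qed.

Lemma tuple_sum_level d (C : pred (seq X)) b s : (d < N)%N ->
  (forall x r, C (x :: r) = ok x && (deg x == d) && below d r) ->
  tuple_sum C (b :: s) = incr g (thetas d) (theta ^+ d) << b :: s >>.
Proof.
move=> dN CE; rewrite tuple_sum_cons incr1 /= addrAC subrr add0r.
rewrite -tuple_sum_below ?(ltnW dN) // -gh // mulr_suml [RHS]big_mkcond.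
apply: eq_bigr => x _; rewrite (eq_tuple_sum _ (CE x)) tuple_sum_guard.
by case: ifP => _; rewrite ?mulr0.
Qed.

End Chains.

Lemma decreasing_from_cons d k r :
  decreasing_from d (k :: r) = (k == d) && path gtn d r.
Proof.
rewrite /decreasing_from /=; have -> : (Some k == Some d) = (k == d) by [].
by case: eqVneq => // ->.
Qed.

Lemma sum_monic N k (f : K -> K) : (k < N)%N ->
  \sum_(p : {poly_N F} | ((val p : {poly F}) \is monic) && ((size p).-1 == k)) f (val p)%:F
    = \sum_(v <- fspan (thetas k)) f (theta ^+ k + v).
Proof.
move=> kN; rewrite -big_filter -(big_map (fun p : {poly_N F} => (val p)%:F) xpredT f).
rewrite -(big_map (fun v => theta ^+ k + v) xpredT f); apply: perm_big.
apply: uniq_perm.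
- rewrite map_inj_uniq ?filter_uniq ?index_enum_uniq // => p p' /eqP.
  by rewrite tofrac_eq => /eqP /val_inj.
- by rewrite map_inj_uniq ?fspan_uniq ?findep_thetas //; apply: addrI.
move=> y; apply/mapP/mapP => [[p]|[v /mem_fspan_thetas[p pk ->] ->]].
  rewrite mem_filter => /andP[/andP[pm /eqP pk] _ ->].
  have sp : size (val p) = k.+1.
    by rewrite -pk prednK // size_poly_gt0 monic_neq0.
  exists (val p - 'X^k)%:F; last by rewrite tofracB tofracXn addrC subrK.
  apply/mem_fspan_thetas; exists (val p - 'X^k) => //; apply/leq_sizeP => j kj.
  rewrite coefB coefXn; case: (eqVneq j k) => [->|jk].
    by move/monicP: pm; rewrite /lead_coef sp => ->; rewrite subrr.
  by rewrite subr0 nth_default // sp ltn_neqAle eq_sym jk.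
have sX : size ('X^k + p) = k.+1 by rewrite size_polyDl size_polyXn.
have sN : (size ('X^k + p)%R <= N)%N by rewrite sX.
exists (NPoly sN); last by rewrite /= tofracD tofracXn.
rewrite mem_filter mem_index_enum andbT /= sX eqxx andbT.
by rewrite monicE lead_coefDl ?size_polyXn // lead_coefXn.
Qed.

Lemma Ssum_incr d b s : Ssum F (b :: s) d = incr psum (thetas d) (theta ^+ d) << b :: s >>.
Proof.
apply: (@tuple_sum_level {poly_d.+1 F} (fun p => (val p : {poly F}) \is monic)
  (fun p => (size p).-1) (fun p a => ((val p)%:F ^+ a)^-1) d.+1 psum _ d
  (fun r => monic_chain d (map val r))) => //.
  move=> k a kd; exact: (sum_monic (fun y => (y ^+ a)^-1)).
move=> p r; rewrite /monic_chain /below /= decreasing_from_cons -!andbA all_map -map_comp.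
by congr (_ && _); rewrite andbCA.
Qed.

Lemma Sisum_incr d b s : Sisum F (b :: s) d = incr lpow (thetas d) (theta ^+ d) << b :: s >>.
Proof.
apply: (@tuple_sum_level 'I_d.+1 xpredT val (fun k a => (ell F k ^+ a)^-1) d.+1 lpow _ d
  (fun r => decreasing_from d [seq val j | j <- r])) => //.
  move=> k a kd; rewrite (big_pred1 (Ordinal kd)) => [|j]; last by rewrite /= -val_eqE.
  by rewrite /lpow psum1_thetas exprVn.
by move=> p r; rewrite /= decreasing_from_cons /below all_predT.
Qed.

End ChainSums.

(** * Convergence of the zeta and Li series *)

Section SeriesConvergence.
Variable F : finFieldType.
Local Notation K := {fraction {poly F}}.
Local Notation "x %:F" := (@FracField.tofrac _ x).
Local Notation u := (uinf F).
Implicit Types (f g : fps F) (x y : nat -> Kinf F).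

(** Each coefficient of the inverse series depends on all earlier ones; carrying the list of these
    makes the recursion structural. *)
Fixpoint inv_coefs f (n : nat) : seq F :=
  if n is n'.+1 then
    let r := inv_coefs f n' in
    rcons r ((f 0%N)^-1 * ((n' == 0%N)%:R - \sum_(i < n') f i.+1 * r`_(n' - i.+1)))
  else [::].

Definition fps_recip f : fps F := fun n => (inv_coefs f n.+1)`_n.

Lemma size_inv_coefs f n : size (inv_coefs f n) = n.
Proof. by elim: n => //= n IH; rewrite size_rcons IH. Qed.

Lemma nth_inv_coefs f n i : (i < n)%N -> (inv_coefs f n)`_i = fps_recip f i.
Proof.
elim: n => // n IH; rewrite ltnS leq_eqVlt => /orP[/eqP-> //|i_n] /=.
by rewrite nth_rcons size_inv_coefs i_n IH.
Qed.

Lemma fps_mul_recip f : f 0%N != 0 -> f * fps_recip f = 1.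
Proof.
move=> f0; apply/funext => n.
rewrite [LHS]big_ord_recl subn0 [X in _ * X]/fps_recip /= nth_rcons size_inv_coefs.
rewrite ltnn eqxx mulVKf //.
rewrite (eq_bigr (fun i : 'I_n => f i.+1 * fps_recip f (n - i.+1)%N)) => [|i _].
  by rewrite subrK; case: n.
rewrite nth_inv_coefs // ltn_subrL /=; apply: leq_ltn_trans (ltn_ord i); exact: leq0n.
Qed.

Lemma fps_divX f N : (forall i, (i < N)%N -> f i = 0) ->
  exists g, f = fpsX F ^+ N * g.
Proof.
move=> fN; exists (fun n => f (n + N)%N); apply/funext => n.
by rewrite fpsXnM; case: ltnP => [/fN //|Nn]; rewrite subnK.
Qed.

(** The valuation of c at infinity is at least N. *)
Definition uvge (N : nat) (c : Kinf F) : Prop := exists f, c = u ^+ N * f%:F.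

Lemma uvge0 N : uvge N 0.
Proof. by exists 0; rewrite tofrac0 mulr0. Qed.

Lemma uvgeD N a b : uvge N a -> uvge N b -> uvge N (a + b).
Proof. by move=> [f ->] [g ->]; exists (f + g); rewrite tofracD mulrDr. Qed.

Lemma uvgeM N M a b : uvge N a -> uvge M b -> uvge (N + M) (a * b).
Proof. by move=> [f ->] [g ->]; exists (f * g); rewrite tofracM exprD mulrACA. Qed.

Lemma uvge_leq N M a : (M <= N)%N -> uvge N a -> uvge M a.
Proof.
move=> MN [f ->]; exists (fpsX F ^+ (N - M) * f).
by rewrite tofracM tofracXn mulrA -exprD subnKC.
Qed.

Lemma uvge_sum N (I : eqType) (r : seq I) (a : I -> Kinf F) :
  (forall i, i \in r -> uvge N (a i)) -> uvge N (\sum_(i <- r) a i).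
Proof.
move=> aN; rewrite big_seq; elim/big_rec: _ => [|i b ir bN]; first exact: uvge0.
by apply: uvgeD => //; apply: aN.
Qed.

(** A bound on the pole order of c makes multiplication by c continuous. *)
Lemma Kinf_bounded_below (c : Kinf F) : exists m f, u ^+ m * c = f%:F.
Proof.
have d0 : \d_(repr c) != 0 := denom_ratioP _.
have [m [dm dlt]] := fps_neq0 d0; have [g dE] := fps_divX dlt.
have g0 : g 0%N != 0.
  by move: dm; rewrite dE fpsXnM ltnn subnn.
have gr := fps_mul_recip g0.
exists m, (\n_(repr c) * fps_recip g); rewrite {1}[c]frac_numden dE.
have gF : g%:F * (fps_recip g)%:F = 1 :> Kinf F by rewrite -tofracM gr tofrac1.
have gF0 : g%:F != 0 :> Kinf F.
  by apply: contra_eq_neq gF => ->; rewrite mul0r eq_sym oner_eq0.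
rewrite !tofracM tofracXn invfM mulrCA mulVKf ?expf_neq0 ?uinf_neq0 //.
by congr (_ * _); apply: (mulfI gF0); rewrite gF divff.
Qed.

Lemma Kinf_cvg0 : Kinf_cvg (fun=> 0 : Kinf F) 0.
Proof. by move=> N; exists 0%N => n _; rewrite subr0; apply: uvge0. Qed.

Lemma Kinf_cvgD x y l m : Kinf_cvg x l -> Kinf_cvg y m ->
  Kinf_cvg (fun n => x n + y n) (l + m).
Proof.
move=> xl ym N; have [n1 h1] := xl N; have [n2 h2] := ym N.
exists (maxn n1 n2) => n; rewrite geq_max => /andP[/h1 a1 /h2 a2].
by rewrite opprD addrACA; apply: uvgeD.
Qed.

Lemma Kinf_cvgZ c x l : Kinf_cvg x l -> Kinf_cvg (fun n => c * x n) (c * l).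
Proof.
have [m [f cE]] := Kinf_bounded_below c; move=> xl N.
have [n0 h] := xl (N + m)%N; exists n0 => n /h [g gE].
exists (f * g); rewrite -mulrBr gE tofracM -cE exprD; ring.
Qed.

Lemma Kinf_cvg_sum (I : eqType) (r : seq I) (x : I -> nat -> Kinf F) (l : I -> Kinf F) :
  (forall i, i \in r -> Kinf_cvg (x i) (l i)) ->
  Kinf_cvg (fun n => \sum_(i <- r) x i n) (\sum_(i <- r) l i).
Proof.
elim: r => [|i r IH] xl.
  have -> : (fun n => \sum_(i <- [::]) x i n) = (fun=> 0).
    by apply/funext => n; rewrite big_nil.
  by rewrite big_nil; apply: Kinf_cvg0.
have -> : (fun n => \sum_(j <- i :: r) x j n) = (fun n => x i n + \sum_(j <- r) x j n).
  by apply/funext => n; rewrite big_cons.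
rewrite big_cons; apply: Kinf_cvgD; first by apply: xl; rewrite mem_head.
by apply: IH => j jr; apply: xl; rewrite inE jr orbT.
Qed.

Lemma fps_sumE (I : Type) (r : seq I) (a : I -> fps F) n :
  (\sum_(i <- r) a i) n = \sum_(i <- r) a i n.
Proof.
apply: (big_morph (fun f : fps F => f n)) => //.
by rewrite /GRing.zero /=; case: n.
Qed.

(** Term d has valuation at least d, so coefficient n of the limit is a finite sum over d <= n.
    Existence has to be shown because [Kinf_sum] defaults to 0 for a divergent series. *)
Lemma Kinf_sum_cvg (z : nat -> K) : (forall d, uvge d (Kinf_of (z d))) ->
  Kinf_cvg (fun n => \sum_(d < n) Kinf_of (z d)) (Kinf_sum z).
Proof.
move=> /choice[h hE].
suff [l lP] : exists l, Kinf_cvg (fun n => \sum_(d < n) Kinf_of (z d)) l.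
  by apply: (@xgetPex _ 0 (Kinf_cvg (fun n => \sum_(d < n) Kinf_of (z d)))); exists l.
pose G : fps F := fun n => \sum_(d < n.+1) (fpsX F ^+ d * h d) n.
exists G%:F => N; exists N => n Nn.
suff [f fE] : exists f, \sum_(d < n) (fpsX F ^+ d * h d) - G = fpsX F ^+ N * f.
  exists f; rewrite -[_ * f%:F]/(_ * _) -tofracXn -tofracM -fE tofracB; congr (_ - _).
  rewrite rmorph_sum; apply: eq_bigr => d _.
  by rewrite hE /= tofracM tofracXn.
apply: fps_divX => i iN.
rewrite -[LHS]/((\sum_(d < n) (fpsX F ^+ d * h d)) i - G i) fps_sumE /G.
apply/eqP; rewrite subr_eq0; apply/eqP.
rewrite -!(big_mkord xpredT (fun d => (fpsX F ^+ d * h d) i)).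
rewrite [LHS](@big_cat_nat _ _ _ i.+1) ?(leq_trans iN) //=.
rewrite [X in _ + X]big_nat [X in _ + X]big1 ?addr0 // => d /andP[id _].
by rewrite fpsXnM id.
Qed.

End SeriesConvergence.

(** * Comparison of zeta and Li *)

Section ZetaPhi.
Variable F : finFieldType.
Local Notation K := {fraction {poly F}}.
Local Notation SS := {freeg (seq nat) / K}.
Local Notation "x %:F" := (@FracField.tofrac _ x).
Local Notation u := (uinf F).
Local Notation psum := (psum (scalarK F)).
Local Notation theta := (theta F).
Local Notation thetas := (thetas F).
Local Notation positive := (all (fun a => 0 < a)%N).
Implicit Types (P : SS).

(** u^k p(1/u) is a power series whose constant term is the leading coefficient 1, hence it is
    invertible. *)
Lemma uvge_monic_inv (p : {poly F}) k : p \is monic -> size p = k.+1 ->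
  uvge k (Kinf_of (p%:F)^-1).
Proof.
move=> pm pk; rewrite fmorphV /=.
have -> : Kinf_of p%:F = Kinf_of_poly p.
  by rewrite -[p%:F]divr1 -tofrac1 Kinf_of_frac ?oner_eq0 // rmorph1 divr1.
have u0 := uinf_neq0 F.
pose f : fps F := \sum_(i < k.+1) fpsC p`_i * fpsX F ^+ (k - i).
have fE : u ^+ k * Kinf_of_poly p = f%:F.
  rewrite /Kinf_of_poly (@horner_coef_wide _ k.+1); last by rewrite size_map_poly pk.
  rewrite mulr_sumr rmorph_sum; apply: eq_bigr => -[i /= i_k] _.
  rewrite ltnS in i_k; rewrite coef_map /= rmorphM rmorphXn /= mulrCA exprVn.
  by congr (_ * _); rewrite -{1}(subnK i_k) exprD mulfK // expf_neq0.
have f0 : f 0%N != 0.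
  rewrite /f fps_sumE big_ord_recr /= big1 => [|[i /= i_k] _]; last first.
    by rewrite mulrC fpsXnM subn_gt0 i_k.
  rewrite add0r subnn expr0 mulr1 /fpsC /=; move/monicP: pm.
  by rewrite /lead_coef pk /= => ->; rewrite oner_eq0.
exists (fps_recip f).
have p0 : Kinf_of_poly p != 0 by rewrite Kinf_of_poly_eq0 monic_neq0.
apply: (mulfI p0); rewrite divff // mulrCA mulrA.
by rewrite fE -tofracM fps_mul_recip ?tofrac1.
Qed.

Lemma uvgeX N a k : uvge N a -> uvge (N * k) (a ^+ k : Kinf F).
Proof.
move=> aN; elim: k => [|k IH]; first by exists 1; rewrite muln0 expr0 tofrac1 mulr1.
by rewrite exprS mulnS; apply: uvgeM.
Qed.

Lemma uvge_psum d a : uvge (d * a) (Kinf_of (psum (thetas d) (theta ^+ d) a)).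
Proof.
rewrite rmorph_sum; apply: uvge_sum => v /mem_fspan_thetas[p pd ->].
rewrite -exprVn rmorphXn; apply: uvgeX; rewrite /theta -tofracXn -tofracD.
have sX : size ('X^d + p) = d.+1 by rewrite size_polyDl size_polyXn.
by apply: uvge_monic_inv => //; rewrite monicE lead_coefDl ?size_polyXn // lead_coefXn.
Qed.

Lemma uvge_msum d s : uvge 0 (Kinf_of (msum psum (thetas d) s)).
Proof.
elim: d s => [|d IH] [|a s] /=.
- by exists 1; rewrite rmorph1 expr0 mul1r tofrac1.
- by rewrite rmorph0; apply: uvge0.
- by exists 1; rewrite rmorph1 expr0 mul1r tofrac1.
rewrite rmorphD rmorphM; apply: uvgeD; first exact: IH.
by apply: (uvge_leq (leq0n (d * a + 0))); apply: uvgeM; [apply: uvge_psum|apply: IH].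
Qed.

Lemma Ssum_cvg b s : (0 < b)%N ->
  Kinf_cvg (fun n => \sum_(d < n) Kinf_of (Ssum F (b :: s) d)) (Kinf_sum (Ssum F (b :: s))).
Proof.
move=> b0; apply: Kinf_sum_cvg => d.
rewrite Ssum_incr incr1 /= addrAC subrr add0r rmorphM.
apply: (@uvge_leq _ (d * b + 0)); first by rewrite addn0 leq_pmulr.
by apply: uvgeM; [apply: uvge_psum|apply: uvge_msum].
Qed.

Lemma extend_cvg (z : seq nat -> nat -> K) P :
  (forall s, s \in dom P ->
     Kinf_cvg (fun n => \sum_(d < n) Kinf_of (z s d)) (Kinf_sum (z s))) ->
  Kinf_cvg (fun n => \sum_(d < n) Kinf_of (ev (fun s => z s d) P))
    (extend (fun s => Kinf_sum (z s)) P).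
Proof.
move=> zP.
have -> : (fun n => \sum_(d < n) Kinf_of (ev (fun s => z s d) P))
    = (fun n => \sum_(s <- dom P) Kinf_of (coeff s P) * \sum_(d < n) Kinf_of (z s d)).
  apply/funext => n; under [RHS]eq_bigr do rewrite mulr_sumr.
  rewrite exchange_big; apply: eq_bigr => d _; rewrite evE rmorph_sum.
  by apply: eq_bigr => s _; rewrite rmorphM.
by apply: Kinf_cvg_sum => s sP; apply: Kinf_cvgZ; apply: zP.
Qed.

Lemma tuples_consP w s : (0 < w)%N -> tuples w s ->
  exists b s', [/\ s = b :: s', (0 < b)%N & positive s'].
Proof.
move=> w0 ws; have := tuples_neq0 w0 ws; case: ws; case: s => // b s /andP[b0 s0] _ _.
by exists b, s.
Qed.

Lemma zeta_cvg w P : (0 < w)%N -> homog w P ->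
  Kinf_cvg (fun n => \sum_(d < n) Kinf_of (incr psum (thetas d) (theta ^+ d) P)) (zeta P).
Proof.
move=> w0 wP.
have -> : (fun n => \sum_(d < n) Kinf_of (incr psum (thetas d) (theta ^+ d) P))
    = (fun n => \sum_(d < n) Kinf_of (ev (fun s => Ssum F s d) P)).
  apply/funext => n; apply: eq_bigr => d _; congr Kinf_of; rewrite incr_ev.
  apply: eq_in_ev => s /wP /(tuples_consP w0)[b [s' [-> _ _]]].
  by rewrite Ssum_incr.
by apply: extend_cvg => s /wP /(tuples_consP w0)[b [s' [-> b0 _]]]; apply: Ssum_cvg.
Qed.

(** Both sides are limits of the same sequence of partial sums. *)
Lemma zeta_phi w P : (0 < w)%N -> homog w P -> zeta (phi P) = Li P.
Proof.
move=> w0 wP; apply: Kinf_cvg_uniq (zeta_cvg w0 (homog_phi wP)) _.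
have phiE Q : homog w Q ->
    (fun n => \sum_(d < n) Kinf_of (incr psum (thetas d) (theta ^+ d) (phi Q)))
    = (fun n => \sum_(d < n) Kinf_of (ev (fun s => Sisum F s d) Q)).
  move=> wQ; apply/funext => n; apply: eq_bigr => d _; congr Kinf_of.
  rewrite (incr_phi (findep_thetas F d.+1) wQ) incr_ev.
  apply: eq_in_ev => s /wQ /(tuples_consP w0)[b [s' [-> _ _]]].
  by rewrite Sisum_incr.
rewrite phiE //; apply: extend_cvg => s /wP ws.
(* Convergence of the Li series of s is inherited from the zeta series of phi(s), which has the same
   partial sums. *)
have := zeta_cvg w0 (homog_phi (homog1 ws)); rewrite phiE; last exact: homog1.
have -> : (fun n => \sum_(d < n) Kinf_of (ev (fun t => Sisum F t d) << s >>))
    = (fun n => \sum_(d < n) Kinf_of (Sisum F s d)).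
  by apply/funext => n; apply: eq_bigr => d _; rewrite ev1.
move=> h; apply: (@xgetPex _ 0 (Kinf_cvg (fun n => \sum_(d < n) Kinf_of (Sisum F s d)))).
by exists (zeta (phi << s >>)).
Qed.

End ZetaPhi.

Theorem theorem2p12 (F : finFieldType) :
  (forall n : nat, (0 < n)%N ->
     Rzeta (#|F| + n) =
       lin_span ([set overline (opBS U (R1 F)) | U in tuples n]
             `|` [set overline (opCS V (R1 F)) | V in tuples n]
             `|` [set P | exists (l m : nat) (U V : seq nat),
                    [/\ tuples l U, tuples m V, (l + m = n)%N
                      & P = overline (opBS U (opCS V (R1 F)))]]))
  <->
  (forall n : nat, (0 < n)%N ->
     RLi (#|F| + n) =
       lin_span ([set overline (opBSi U (R1 F)) | U in tuples n]
             `|` [set overline (opCSi V (R1 F)) | V in tuples n]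
             `|` [set P | exists (l m : nat) (U V : seq nat),
                    [/\ tuples l U, tuples m V, (l + m = n)%N
                      & P = overline (opBSi U (opCSi V (R1 F)))]])).
Proof.
have w0 n : (0 < #|F| + n)%N by rewrite addn_gt0 (ltnW (finNzRing_gt1 F)).
split=> H n n0; have := H n n0.
  have eS := generatorsE (starS F) (diamS F) n.
  have eSi := generatorsE (starSi F) (diamSi F) n.
  move=> Hn; rewrite [X in Rzeta _ = lin_span X]eS in Hn.
  rewrite [X in _ = lin_span X]eSi; apply/seteqP; split=> P.
    move=> [wP LP]; have : Rzeta (#|F| + n) (phi P).
      by split; [exact: homog_phi|rewrite (zeta_phi (w0 n) wP)].
    (* phi(P) lies in the span for S and lifts to some Q in the span for Si; injectivity of phi
       gives Q = P. *)
    rewrite Hn => /spanS_phi[Q sQ] /(phi_inj (homog_spanSi sQ) wP) <-.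
    exact: sQ.
  move=> sP; have wP := homog_spanSi sP; split=> //.
  rewrite -(zeta_phi (w0 n) wP).
  have : Rzeta (#|F| + n) (phi P) by rewrite Hn; apply: phi_spanSi.
  by case.
have eS := generatorsE (starS F) (diamS F) n.
have eSi := generatorsE (starSi F) (diamSi F) n.
move=> Hn; rewrite [X in RLi _ = lin_span X]eSi in Hn.
rewrite [X in _ = lin_span X]eS; apply/seteqP; split=> P.
  (* By surjectivity every zeta relation is phi(Q), and Q is then a relation for Li. *)
  move=> [/phi_onto[Q wQ <-] zQ].
  apply: phi_spanSi; have : RLi (#|F| + n) Q by split; rewrite -?(zeta_phi (w0 n) wQ).
  by rewrite Hn.
move=> /spanS_phi[Q]; rewrite -Hn => -[wQ LQ] <-.
by split; [exact: homog_phi|rewrite (zeta_phi (w0 n) wQ)].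
Qed.
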